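(* The generating function $$\mathfrak J=\prod_{i=1}^{n-1}\mathsf Q_i^{\frac{-\log(t_1\cdots t_i)}{\hbar}}\sum_{\underline d\in\mathbb Z_{\ge0}^{n-1}}[R\Gamma(\mathfrak Q_{\underline d},\mathcal O_{\mathfrak Q_{\underline d}})]\,\mathsf Q_1^{d_1}\cdots\mathsf Q_{n-1}^{d_{n-1}}$$ satisfies the $v$-difference Toda equation $$\mathfrak G\,\mathfrak J=\Big(\sum_{i=1}^nt_i^{2}\Big)\mathfrak J,\qquad \mathfrak G:=\mathsf T_1^2+\mathsf T_2^2(1-\mathsf Q_1)+\dots+\mathsf T_n^2(1-\mathsf Q_{n-1}).$$
   Context: Work over $\mathbb C$; $n\ge2$. $\mathbf C=\mathbb P^1$ with coordinate $z$ and points $0,\infty$; $\mathbb C^*$ acts by $v(z)=v^{-2}z$. $W$ is a vector space with basis $w_1,\dots,w_n$; the torus $\widetilde T=\{(t_1,\dots,t_n): t_1\cdots t_n=1\}$ acts on $W$ by $\underline t(w_i)=t_i^2w_i$. For $\underline d=(d_1,\dots,d_{n-1})\in\mathbb Z_{\ge0}^{n-1}$, $\mathfrak Q_{\underline d}$ is the moduli space of flags of locally free subsheaves $0\subset\mathcal W_1\subset\dots\subset\mathcal W_{n-1}\subset W\otimes\mathcal O_{\mathbf C}$ with $\operatorname{rank}\mathcal W_k=k$, $\deg\mathcal W_k=-d_k$, such that near $\infty$ each $\mathcal W_i$ is a vector subbundle with fibre $\langle w_1,\dots,w_i\rangle$ at $\infty$. It is a smooth quasiprojective variety of dimension $2\sum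 d_i$ with an action of $\widetilde T\times\mathbb C^*$. Its $\widetilde T\times\mathbb C^*$-fixed points are indexed by collections $\widetilde{\underline d}=(d_{ij})_{1\le j\le i\le n-1}$ of nonnegative integers with $d_i=\sum_{j\le i}d_{ij}$ and $d_{kj}\ge d_{ij}$ for $i\ge k\ge j$; the corresponding flag is $\mathcal W_i=\bigoplus_{j\le i}\mathcal O_{\mathbf C}(-d_{ij}\cdot0)w_j$. Convention for characters: the function $z$ has character $v^{-2}$ and $w_i$ has character $t_i^2$, so e.g. $\operatorname{Hom}(\mathcal O_{\mathbf C}(-a\cdot 0),\mathcal O_{\mathbf C})$ has character $\sum_{c=0}^av^{2c}$. The formal character $[R\Gamma(\mathfrak Q_{\underline d},\mathcal O_{\mathfrak Q_{\underline d}})]$ is the rational function in $t_1,\dots,t_n,v$ (with $t_1\cdots t_n=1$) given by localization as $\sum_xS\chi_x$, the sum over the fixed points $x$ of $\mathfrak Q_{\underline d}$, where $S\chi_x=\prod_\chi(1-\chi)^{-1}$ over the weights $\chi$ of $T_x\mathfrak Q_{\underline d}$ (the character of $\operatorname{Sym}^\bullet T_x\mathfrak Q_{\underline d}$). Formal variables: $\mathsf z_1,\dots,\mathsf z_n$; $\mathsf Q_i=\exp(\mathsf z_i-\mathsf z_{i+1})$ for $1\le i\le n-1$; $\hbar=\log(v)$, so that $v=\exp(\hbar)$. The shift operators $\mathsf T_i$, $1\le i\le n$, act by $\mathsf T_if(\mathsf z_1,\dots,\mathsf z_n)=f(\mathsf z_1,\dots,\mathsf z_i+\hbar,\dots,\mathsf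 z_n)$ on the space of functions of $\mathsf z_1,\dots,\mathsf z_n$ invariant under simultaneous translation of all $\mathsf z_j$. $\mathsf T_k^2(1-\mathsf Q_{k-1})$ is a composition of operators: first multiply by $1-\mathsf Q_{k-1}$, then apply $\mathsf T_k^2$.
   Formalization: The eigenvalue is Σ t_i^{-2} instead of the printed Σ t_i^2: T_k^2 multiplies the prefactor by t_k^{-2} and the degree-0 character is 1, so the printed equation fails in degree 0 for n≥3; for n=2 the two sums agree. *)

(* Defs.v *)
(* MathComp and MathComp-Analysis, with complex numbers from real_closed. *)
From mathcomp Require Import all_boot all_order all_algebra.
From mathcomp Require Import complex.
From mathcomp Require Import all_classical all_reals all_analysis.

Set Implicit Arguments.
Unset Strict Implicit.
Unset Printing Implicit Defensive.

Import Order.TTheory GRing.Theory Num.Theory.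
Local Open Scope ring_scope.

(* Throughout n = r.+1 and indices start at 0: w_(j+1) is indexed by
   j : 'I_r.+1, and W_(k+1), d_(k+1), Q_(k+1) are indexed by k : 'I_r.
   In particular W_(k+1) has generic basis the w_(j+1) with j <= k. *)

Definition cexp (R : realType) (x : R[i]) : R[i] :=
  ((expR (complex.Re x) * cos (complex.Im x))
    +i* (expR (complex.Re x) * sin (complex.Im x)))%C.

Section TangentSpace.
Variables (R : realType) (r : nat).

(* Fixed points of degree d. The entries D k j with k < j, absent from the
   collection (d_ij)_(j <= i), are set to 0. *)
Definition fixed_point (d : {ffun 'I_r -> nat}) (D : 'M[nat]_(r, r.+1)) : bool :=
  [&& [forall k : 'I_r, forall j : 'I_r.+1, (k < j)%N ==> (D k j == 0%N)],
      [forall k : 'I_r, (\sum_(j < r.+1) D k j)%N == d k] &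
      [forall i : 'I_r, forall k : 'I_r, forall j : 'I_r.+1,
         (j <= k <= i)%N ==> (D i j <= D k j)%N]].

(* Sections of W (x) O over the affine line P^1 minus infinity. *)
Local Notation sect := 'rV[{poly R[i]}]_r.+1.

(* Sections over the affine line of the sheaf
   \bigoplus_(j <= k) O(- D k j . 0) w_j. *)
Definition subsheaf (D : 'M[nat]_(r, r.+1)) (k : 'I_r) (m : sect) : Prop :=
  forall j : 'I_r.+1,
    if (j <= k)%N then 'X^(D k j) %| m 0 j else m 0 j == 0.

(* The k-th component represents, by lifting the values to W (x) O, a map from
   the k-th subsheaf M_k to (W (x) O) / M_k; its values outside M_k are
   irrelevant. *)
Definition cochain := 'I_r -> sect -> sect.

Definition same_cochain (D : 'M[nat]_(r, r.+1)) (phi psi : cochain) : Prop :=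
  forall k m, subsheaf D k m -> subsheaf D k (phi k m - psi k m).

(* The tangent space at the flag M of the moduli space of based flags of
   subsheaves (first order deformations): families of O-linear maps
     phi_k : M_k -> (W (x) O / M_k)(- infinity)
   such that phi_(k+1) restricted to M_k is phi_k modulo M_(k+1).
   The twist by -infinity expresses that the fibre <w_0, ..., w_k> of M_k at
   infinity is kept. Near infinity M_k is spanned by w_0, ..., w_k and the
   quotient by the other w_j, so that regularity and vanishing at infinity mean
   that the w_j-coordinate of phi_k m, j > k, has degree < s whenever m has
   degree <= s. *)
Definition tangent_vector (D : 'M[nat]_(r, r.+1)) (phi : cochain) : Prop :=
  [/\ forall k (p : {poly R[i]}) m m', subsheaf D k m -> subsheaf D k m' ->
        subsheaf D k (phi k (p *: m + m') - (p *: phi k m + phi k m')),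
      forall k m (s : nat), subsheaf D k m ->
        (forall j, (size (m 0%R j) <= s.+1)%N) ->
        forall j : 'I_r.+1, (k < j)%N -> (size (phi k m 0%R j) <= s)%N &
      forall k k' : 'I_r, k' = k.+1 :> nat -> forall m, subsheaf D k m ->
        subsheaf D k' (phi k' m - phi k m)].

(* z^a w_j |-> v^(-2a) t_j^2 z^a w_j *)
Definition torus_sect (t : 'I_r.+1 -> R[i]) (v : R[i]) (m : sect) : sect :=
  \row_j (t j ^+ 2 *: (m 0 j \Po (v ^- 2 *: 'X))).

Definition torus_act (t : 'I_r.+1 -> R[i]) (v : R[i]) (phi : cochain) : cochain :=
  fun k m => torus_sect t v (phi k (torus_sect (fun j => (t j)^-1) v^-1 m)).

Definition in_torus (t : 'I_r.+1 -> R[i]) (v : R[i]) : Prop :=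
  \prod_j t j = 1 /\ v != 0.

(* (a, b) stands for the character t^a v^b. *)
Local Notation character := ({ffun 'I_r.+1 -> int} * int)%type.

Definition char_val (chi : character) (t : 'I_r.+1 -> R[i]) (v : R[i]) : R[i] :=
  (\prod_j t j ^ chi.1 j) * v ^ chi.2.

(* s lists, with multiplicities, the weights of the tangent space at D: the
   tangent space has a basis e of weight vectors of weights s. *)
Definition tangent_weights (D : 'M[nat]_(r, r.+1)) (s : seq character) : Prop :=
  exists e : 'I_(size s) -> cochain,
    [/\ forall i, tangent_vector D (e i),
        forall phi, tangent_vector D phi ->
          exists! c : 'rV[R[i]]_(size s),
            same_cochain D phi (fun k m => \sum_i (c 0 i)%:P *: e i k m) &
        forall i t v, in_torus t v ->
          same_cochain D (torus_act t v (e i))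
            (fun k m => (char_val (tnth (in_tuple s) i) t v)%:P *: e i k m)].

(* The value at (t, v) of the character of Sym of the tangent space at D. *)
Definition S_chi (D : 'M[nat]_(r, r.+1)) (t : 'I_r.+1 -> R[i]) (v : R[i]) : R[i] :=
  \prod_(chi <- xget [::] [set s | tangent_weights D s])
    (1 - char_val chi t v)^-1.

(* The localization sum [RGamma(Q_d, O)] at (t, v). All the entries of a fixed
   point of degree d are at most \sum_k d k. *)
Definition RGamma (d : {ffun 'I_r -> nat}) (t : 'I_r.+1 -> R[i]) (v : R[i]) : R[i] :=
  \sum_(D : 'M['I_(\sum_k d k)%N.+1]_(r, r.+1) |
          fixed_point d (map_mx (@nat_of_ord _) D))
    S_chi (map_mx (@nat_of_ord _) D) t v.

End TangentSpace.

Section Toda.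
Variables (R : realType) (r : nat).

Local Notation pt := ('I_r.+1 -> R[i]).

(* Q_i^s, where Q_i = exp (z_i - z_(i+1)). *)
Definition Qpow (i : 'I_r) (s : R[i]) (z : pt) : R[i] :=
  cexp (s * (z (lift ord_max i) - z (lift ord0 i))).

Definition Qvar (i : 'I_r) (z : pt) : R[i] := Qpow i 1 z.

(* A formal series \sum_d f_d, with f_d(z) its part of degree d in the formal
   variables Q. The f_d are functions of z on which the shift operators act;
   these preserve the degree, since they multiply each Q_i by a constant. *)
Definition Qseries := {ffun 'I_r -> nat} -> pt -> R[i].

Definition Tshift (hbar : R[i]) (k : 'I_r.+1) (f : Qseries) : Qseries :=
  fun d z => f d (fun j => if j == k then z j + hbar else z j).

Definition mulQ (i : 'I_r) (f : Qseries) : Qseries :=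
  fun d z => if (0 < d i)%N
             then Qvar i z * f [ffun k => (d k - (k == i))%N] z
             else 0.

(* T_1^2 + \sum_(i = 1)^(n-1) T_(i+1)^2 (1 - Q_i) *)
Definition toda (hbar : R[i]) (f : Qseries) : Qseries :=
  fun d z =>
    Tshift hbar ord0 (Tshift hbar ord0 f) d z
    + \sum_(i < r)
        Tshift hbar (lift ord0 i) (Tshift hbar (lift ord0 i)
          (fun d' z' => f d' z' - mulQ i f d' z')) d z.

(* logt i is a logarithm of t_0 ... t_i, and v = exp hbar. The shift T_i
   multiplies the prefactor by t_0 ... t_(i-1) / (t_0 ... t_i) = t_i^-1; as
   RGamma 0 = 1, the degree 0 part of (toda J) is \sum_i t_i^-2 times that of
   J. Hence the eigenvalue of toda on J can only be \sum_i t_i^-2. It equals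
   \sum_i t_i^2 for n = 2, where t_0 t_1 = 1, but not in general for n > 2. *)
Definition Jfun (hbar : R[i]) (t : pt) (logt : 'I_r -> R[i]) : Qseries :=
  fun d z =>
    (\prod_i Qpow i (- logt i / hbar) z)
    * (RGamma d t (cexp hbar) * \prod_i Qvar i z ^+ d i).

(* (t, v) is outside the locus where some nontrivial character t_i^2 t_j^-2 v^(2m)
   takes the value 1; these are the only possible poles of RGamma, whose values
   on this dense set determine it as a rational function. *)
Definition generic (t : pt) (v : R[i]) : Prop :=
  forall (i j : 'I_r.+1) (m : int),
    t i ^+ 2 = t j ^+ 2 * v ^ (2 * m) -> i = j /\ m = 0.

End Toda.

(* Main.v *)
Require Import Defs.
From mathcomp Require Import all_boot all_order all_algebra.
From mathcomp Require Import complex.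
From mathcomp Require Import all_classical all_reals all_analysis.
From mathcomp Require Import zify ring lra.

(* With q = v^2 and y_j = t_j^2, the tangent space at a fixed point splits, according to the pairs
   (j, l), into spaces of polynomials satisfying monomial compatibility conditions. Solving these
   gives an explicit basis of weight vectors, and the product over its weights is
     S_D = \prod_k \prod_(j <= k)
             \prod_(l <= k) (q y_l / y_j; q)_(D k j - D k l)
             / \prod_(l <= k + 1) (q y_l / y_j; q)_(D k j - D (k + 1) l).
   Summing over the rows of D one after the other, from the last one down, one gets functions
   F_m(d; p), where p is the row below; the case m = r, p = 0 is [RGamma(Q_d, O)]. They satisfy
     F_m(d; p) = \sum_i F_m(d; p + e_i) / \prod_(j != i) (1 - Y_i / Y_j),   Y_i = y_i q^(- p_i),
   which holds term by term by Lagrange interpolation, and then the Toda equation, by induction on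
   m: its last summand involves F_(m+1)(d - e_m; p), where the relation above for F_m permits to
   shift the summation index a to a + e_i, and the coefficients of F_m(d; a) agree by a second
   interpolation formula, at the nodes q^(a_j) / y_j. *)

Set Implicit Arguments.
Unset Strict Implicit.
Unset Printing Implicit Defensive.
Import Order.TTheory GRing.Theory Num.Theory.
Local Open Scope ring_scope.

(** * Lagrange interpolation *)

(** The lower row p is kept as a parameter because the equation at p = 0 alone gives no induction:
    F_(m+1) involves F_m at every row a. For a row p with sum d_m the eigenvalue is \sum_j q^(p_j) /
    y_j, which at p = 0 becomes \sum_j t_j^-2. The parameter also produces the interpolation nodes:
    p |-> p + e_i multiplies the term of a row a by \prod_j (1 - Y_i q^(a_j) / y_j), a polynomial in
    Y_i whose value at 0 is 1. Two obstacles shape the formula for S_D. The compatibility conditions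
    between consecutive subsheaves determine some coordinates by the next row and others by the
    previous one; when j < l both kinds occur, and the product over the free coordinates agrees with
    the formula only after telescoping over the rows, not row by row. Moreover, the list of weights
    in the definition of [S_chi] is an unspecified choice, so that the product has to be shown
    independent of the basis of weight vectors. *)

Section Interpolation.
Variable F : fieldType.

(** The coefficient of [g.[u i]] is the value at 0 of the Lagrange basis polynomial [L i], since (0
    - u_j) / (u_i - u_j) = 1 / (1 - u_i / u_j). *)
Lemma interpolation_at0 m (u : 'I_m -> F) (g : {poly F}) :
  injective u -> (forall i, u i != 0) -> (size g <= m)%N ->
  \sum_i g.[u i] / (\prod_(j | j != i) (1 - u i / u j)) = g.[0].
Proof.
move=> u_inj u_neq0 size_g.
have du i j : j != i -> u i - u j != 0.
  by move=> neq_ji; rewrite subr_eq0 (inj_eq u_inj) eq_sym.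
pose L i := \prod_(j | j != i) ((u i - u j)^-1 *: ('X - (u j)%:P)).
pose P := g - \sum_i g.[u i] *: L i.
have Lii i : (L i).[u i] = 1.
  rewrite horner_prod big1 // => j neq_ji.
  by rewrite !hornerE mulVf ?du.
have Lij i j : j != i -> (L i).[u j] = 0.
  move=> neq_ji; rewrite horner_prod (bigD1 j) //= !hornerE subrr mulr0.
  by rewrite mul0r.
have size_L i : (size (L i) <= m)%N.
  rewrite (leq_trans (size_poly_prod_leq _ _)) //.
  have -> : #|[pred j | j != i]| = m.-1 by rewrite cardC1 card_ord.
  have m_gt0 : (0 < m)%N := leq_ltn_trans (leq0n i) (ltn_ord i).
  have : (\sum_(j | j != i) size ((u i - u j)^-1 *: ('X - (u j)%:P)) <=
          \sum_(j < m | j != i) 2)%N.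
    by apply: leq_sum => j _; rewrite (leq_trans (size_scale_leq _ _)) ?size_XsubC.
  rewrite sum_nat_const.
  have -> : #|[pred j | j != i]| = m.-1 by rewrite cardC1 card_ord.
  lia.
have P0 : P = 0.
  apply: (@roots_geq_poly_eq0 _ _ [seq u i | i <- enum 'I_m]).
  - apply/allP => _ /mapP[i _ ->]; rewrite /root /P !hornerE horner_sum.
    rewrite (bigD1 i) //= big1 => [|j neq_ji]; last first.
      by rewrite hornerZ Lij ?mulr0 // eq_sym.
    by rewrite hornerZ Lii mulr1 addr0 subrr.
  - by rewrite map_inj_uniq ?enum_uniq.
  - rewrite size_map size_enum_ord (leq_trans (size_polyD _ _)) // geq_max.
    rewrite size_g size_polyN (leq_trans (size_sum _ _ _)) //.
    apply/bigmax_leqP => i _.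
    by rewrite (leq_trans (size_scale_leq _ _)).
have -> : g.[0] = (\sum_i g.[u i] *: L i).[0].
  by apply/eqP; rewrite -subr_eq0 -hornerN -hornerD -/P P0 horner0.
rewrite horner_sum; apply: eq_bigr => i _; rewrite hornerZ; congr (_ * _).
rewrite horner_prod -prodfV; apply: eq_bigr => j neq_ji.
rewrite !hornerE; have := du i j neq_ji; have := u_neq0 j => uj0 uij0.
field; rewrite uj0 /= uij0 /=.
by rewrite -opprB oppr_eq0.
Qed.

Lemma prod_XsubC_lead m (a : 'I_m -> F) :
  exists2 e : {poly F}, (size e <= m)%N &
    \prod_i ('X - (a i)%:P) = 'X^m + e.
Proof.
elim: m a => [|m IHm] a.
  by exists 0; rewrite ?size_poly0 // big_ord0 expr0 addr0.
rewrite big_ord_recr /=; have [e size_e ->] := IHm (fun i => a (widen_ord (leqnSn m) i)).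
exists (e * 'X - (a ord_max)%:P * ('X^m + e)); last first.
  by rewrite mulrBr exprSr; ring.
rewrite (leq_trans (size_polyD _ _)) // geq_max size_polyN.
rewrite (leq_trans (size_polyMleq _ _)) ?size_polyX /=; last by rewrite addn2.
rewrite mul_polyC (leq_trans (size_scale_leq _ _)) // (leq_trans (size_polyD _ _)) //.
by rewrite geq_max size_polyXn leqnn /= ltnW.
Qed.

(* The extra factor 'X makes the statement meaningful for m = 0. *)
Lemma prod_XsubC_sublead m (a : 'I_m -> F) :
  exists2 e : {poly F}, (size e <= m)%N &
    'X * \prod_i ('X - (a i)%:P) = 'X^(m.+1) - (\sum_i a i) *: 'X^m + e.
Proof.
elim: m a => [|m IHm] a.
  by exists 0; rewrite ?size_poly0 // !big_ord0 scale0r subr0 addr0 mulr1.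
rewrite !big_ord_recr /=; set b := fun i => a (widen_ord (leqnSn m) i).
have [e size_e Ee] := IHm b; have [e' size_e' Ee'] := prod_XsubC_lead b.
exists (e * 'X - a ord_max *: (e' * 'X)); last first.
  set P := \prod_(i < m) _ in Ee Ee' *.
  have -> : 'X * (P * ('X - (a ord_max)%:P))
    = ('X * P) * 'X - (a ord_max)%:P * 'X * P by ring.
  by rewrite Ee Ee' -!mul_polyC polyCD !exprSr; ring.
have sizeX (p : {poly F}) : (size p <= m)%N -> (size (p * 'X)%R <= m.+1)%N.
  by move=> sp; rewrite (leq_trans (size_polyMleq _ _)) // size_polyX addn2 /= ltnS.
rewrite (leq_trans (size_polyD _ _)) // geq_max size_polyN sizeX //=.
by rewrite (leq_trans (size_scale_leq _ _)) // sizeX.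
Qed.

(** The polynomial [f] has degree m + 1, too large for interpolation at the m nodes [x]. Subtracting
    [('X + c) * R] does not change its values there, and [c] is the constant that cancels the
    coefficient of 'X^m. Interpolating the remainder [h] at 0 gives h(0) = f(0) - c R(0); the term
    f(0) accounts for the -1 on the left, and c R(0) for the right-hand side. *)
Lemma interpolation_sum m (x : 'I_m -> F) (Y : 'I_m.+1 -> F) :
  injective x -> (forall i, x i != 0) -> (forall l, Y l != 0) ->
  (\prod_i x i * \prod_l Y l)^-1 *
    (\sum_i (\prod_l (1 - Y l * x i)) / (\prod_(l | l != i) (1 - x i / x l)) - 1)
  = \sum_i x i - \sum_l (Y l)^-1.
Proof.
move=> x_inj x0 Y0.
pose c := \sum_i x i - \sum_l (Y l)^-1.
pose f := \prod_l ('X - (Y l)^-1%:P).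
pose R := \prod_i ('X - (x i)%:P).
pose h := f - ('X + c%:P) * R.
have size_h : (size h <= m)%N.
  rewrite /h /f big_ord_recr /=.
  set b := fun l => (Y (widen_ord (leqnSn m) l))^-1.
  have [e1 s1 E1] := prod_XsubC_lead b; have [e2 s2 E2] := prod_XsubC_sublead b.
  have [e3 s3 E3] := prod_XsubC_lead x; have [e4 s4 E4] := prod_XsubC_sublead x.
  have -> : \prod_(i < m) ('X - (b i)%:P) * ('X - (Y ord_max)^-1%:P)
            - ('X + c%:P) * R
     = e2 - (Y ord_max)^-1 *: e1 - e4 - c *: e3.
    rewrite mulrBr [_ * 'X]mulrC E2 E1 [('X + _) * _]mulrDl /R E4 E3 /c big_ord_recr /= -/b.
    by rewrite -!mul_polyC !(polyCD, polyCN); ring.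
  rewrite !(leq_trans (size_polyD _ _)) // !geq_max ?size_polyN.
  rewrite (leq_trans (size_polyD _ _)) ?geq_max ?size_polyN.
    by rewrite (leq_trans (size_scale_leq _ _)).
  rewrite s4 andbT (leq_trans (size_polyD _ _)) ?geq_max ?size_polyN //.
  by rewrite s2 /= (leq_trans (size_scale_leq _ _)).
have hx i : h.[x i] = (\prod_l - (Y l)^-1) * \prod_l (1 - Y l * x i).
  have Rx0 : R.[x i] = 0.
    by rewrite horner_prod (bigD1 i) //= hornerXsubC subrr mul0r.
  rewrite /h hornerD hornerN hornerM Rx0 mulr0 subr0 /f horner_prod.
  rewrite -big_split; apply: eq_bigr => l _ /=; rewrite !hornerE.
  by have := Y0 l => Yl0; field.
set S := \sum_(i < m) _ / _.
have := interpolation_at0 x_inj x0 size_h.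
have -> : \sum_i h.[x i] / (\prod_(j | j != i) (1 - x i / x j)) =
          (\prod_l - (Y l)^-1) * S.
  by rewrite mulr_sumr; apply: eq_bigr => i _; rewrite hx -mulrA.
have -> : h.[0] = \prod_l - (Y l)^-1 - c * \prod_i - x i.
  rewrite /h !hornerE /R /f !horner_prod.
  by congr (_ - c * _); apply: eq_bigr => i _; rewrite !hornerE.
rewrite !prodrN !card_ord prodfV exprS.
set PY := \prod_l Y l; set PX := \prod_i x i => H.
have PY0 : PY != 0 by apply/prodf_neq0.
have PX0 : PX != 0 by apply/prodf_neq0.
have s0 : (-1 : F) ^+ m != 0 by rewrite signr_eq0.
apply: (mulfI (mulf_neq0 s0 PX0)).
have {}H : (-1) ^+ m * PY^-1 * S = (-1) ^+ m * PY^-1 + c * ((-1) ^+ m * PX).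
  apply: oppr_inj; transitivity (-1 * (-1) ^+ m / PY * S); first by ring.
  by rewrite H; ring.
transitivity (c * ((-1) ^+ m * PX)); last by rewrite mulrC.
have -> : c * ((-1) ^+ m * PX) = (-1) ^+ m * PY^-1 * S - (-1) ^+ m * PY^-1.
  by rewrite H; ring.
by field; apply/andP.
Qed.
End Interpolation.

(** * The sums F_m and their Toda equation *)

Section FermionicSum.
Variables (F : fieldType) (q : F) (y : nat -> F) (r : nat).

(* 1 / (q A; q)_m, for m of any sign. *)
Definition qpochV (A : F) (m : int) : F :=
  match m with
  | Posz k => \prod_(i < k) (1 - q ^+ i.+1 * A)^-1
  | Negz k => \prod_(i < k.+1) (1 - q ^- i * A)
  end.

(** For [a] and [p] the rows m and m + 1 of D, [Knum m a * Kden m a p] is the factor k = m of the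
    product formula for S_D. The diagonal factors l = j, equal to 1, are left out of [Knum]. *)
Definition Knum (m : nat) (a : nat -> nat) : F :=
  \prod_(j < m.+1) \prod_(l < m.+1 | l != j)
    (qpochV (y l / y j) ((a j)%:Z - (a l)%:Z))^-1.

Definition Kden (m : nat) (a p : nat -> nat) : F :=
  \prod_(j < m.+1) \prod_(l < m.+2) qpochV (y l / y j) ((a j)%:Z - (p l)%:Z).

Definition addrow (p : nat -> nat) (i j : nat) : nat := (p j + (j == i))%N.

Definition xnode (a : nat -> nat) (j : nat) : F := q ^+ a j / y j.
Definition ynode (p : nat -> nat) (j : nat) : F := y j / q ^+ p j.

Lemma eq_Knum m a a' :
  (forall j, (j <= m)%N -> a j = a' j) -> Knum m a = Knum m a'.
Proof.
by move=> E; apply: eq_bigr => j _; apply: eq_bigr => l _; rewrite !E // -ltnS.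
Qed.

Lemma eq_Kden m a a' p p' :
  (forall j, (j <= m)%N -> a j = a' j) -> (forall j, (j <= m.+1)%N -> p j = p' j) ->
  Kden m a p = Kden m a' p'.
Proof.
move=> E E'; apply: eq_bigr => j _; apply: eq_bigr => l _.
by rewrite E ?E' // -ltnS.
Qed.

(** The factor with l = j has argument A = 1 and negative index, hence contains 1 - A = 0. In this
    way the inequalities between consecutive rows of a fixed point need not be imposed on the
    sums. *)
Lemma Kden_eq0 m (a p : nat -> nat) j :
  (j <= m)%N -> y j != 0 -> (a j < p j)%N -> Kden m a p = 0.
Proof.
move=> jm yj ap; rewrite /Kden.
rewrite (bigD1 (Ordinal (jm : (j < m.+1)%N))) //=.
rewrite (bigD1 (Ordinal (leqW jm : (j < m.+2)%N))) //=.
have -> : (a j)%:Z - (p j)%:Z = Negz (p j - a j).-1 by lia.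
by rewrite /qpochV big_ord_recl /= divff // expr0 invr1 mulr1 subrr !mul0r.
Qed.

Section Rows.
Variable B : nat.

(** Extending rows by 0 to all of nat lets rows of different lengths share one type of indices; the
    bound [B] makes the sums over rows finite. *)
Definition rowf (a : {ffun 'I_r.+1 -> 'I_B.+1}) (j : nat) : nat :=
  if insub j is Some i then a i else 0%N.

Definition supported (m : nat) (a : {ffun 'I_r.+1 -> 'I_B.+1}) : bool :=
  [forall j : 'I_r.+1, (m <= j)%N ==> (a j == 0%N :> nat)].

(* The F_m(d; p) above; they do not depend on B, a bound for the entries of the rows. *)
Fixpoint Fsum (m : nat) (d : nat -> int) (p : nat -> nat) : F :=
  if m is m'.+1 then
    \sum_(a | supported m a && ((\sum_(j < m) rowf a j)%N%:Z == d m'))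
      Knum m' (rowf a) * Kden m' (rowf a) p * Fsum m' d (rowf a)
  else 1.

Lemma eq_Fsum m d d' p p' :
  (forall k, (k < m)%N -> d k = d' k) -> (forall j, (j <= m)%N -> p j = p' j) ->
  Fsum m d p = Fsum m d' p'.
Proof.
elim: m p p' => [|m IHm] p p' eqd eqp //=.
rewrite (eqd m) //; apply: eq_bigr => a _; congr (_ * _ * _).
  by apply: eq_Kden.
by apply: IHm => // k lt_km; apply: eqd; exact: leqW.
Qed.
End Rows.

Hypothesis q_neq0 : q != 0.
Hypothesis y_neq0 : forall i, (i <= r)%N -> y i != 0.
Hypothesis y_gen : forall i j (m : int), (i <= r)%N -> (j <= r)%N ->
  y i = y j * q ^ m -> i = j /\ m = 0.

Lemma qpochV_factor_neq0 j l (m : int) : (j <= r)%N -> (l <= r)%N ->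
  (j = l -> m != 0) -> 1 - q ^ m * (y l / y j) != 0.
Proof.
move=> jr lr neq; rewrite subr_eq0; apply/negP => /eqP E.
have [] := @y_gen j l m jr lr; last by move=> /neq/eqP.
by rewrite -[LHS]mul1r E mulrA mulfVK ?y_neq0 // mulrC.
Qed.

(** For m > 0 one factor is cancelled, which requires it to be nonzero; for m <= 0 one more factor
    appears. *)
Lemma qpochVB A (m : int) : ((0 < m) -> 1 - q ^ m * A != 0) ->
  qpochV A (m - 1) = (1 - q ^ m * A) * qpochV A m.
Proof.
case: m => [[|k]|k] nz.
- by rewrite /= big_ord0 big_ord1 mulr1 expr0 invr1.
- have -> : (k.+1%:Z - 1 = k%:Z) by lia.
  by rewrite /= big_ord_recr /= mulrCA mulfV ?mulr1 //; exact: nz.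
- have -> : (Negz k - 1 = Negz k.+1) by lia.
  by rewrite /= [LHS]big_ord_recr /= mulrC.
Qed.

(** Adding e_i to a row changes only the factors with one index equal to i; taking a boolean such as
    [l == i] for the shift treats all factors of a double product at once. *)
Lemma qpochV_bool j l (m : int) (b : bool) : (j <= r)%N -> (l <= r)%N ->
  qpochV (y l / y j) (m - b%:Z) =
  (if b then 1 - q ^ m * (y l / y j) else 1) * qpochV (y l / y j) m.
Proof.
case: b => jr lr; last by rewrite subr0 mul1r.
by apply: qpochVB => m_gt0; apply: qpochV_factor_neq0 => // _; rewrite gt_eqF.
Qed.

Lemma xnode_neq0 a j : (j <= r)%N -> xnode a j != 0.
Proof. by move=> jr; rewrite mulf_neq0 ?invr_neq0 ?expf_neq0 ?y_neq0. Qed.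

Lemma ynode_neq0 a j : (j <= r)%N -> ynode a j != 0.
Proof. by move=> jr; rewrite mulf_neq0 ?invr_neq0 ?expf_neq0 ?y_neq0. Qed.

Lemma node_qpow a p j l :
  q ^ ((a j)%:Z - (p l)%:Z) * (y l / y j) = ynode p l * xnode a j.
Proof. by rewrite expfzDr // -exprnN /xnode /ynode -exprnP; ring. Qed.

Lemma xnode_div a j l : (j <= r)%N -> (l <= r)%N ->
  q ^ ((a j)%:Z - (a l)%:Z) * (y l / y j) = xnode a j / xnode a l.
Proof.
move=> jr lr; rewrite expfzDr // -exprnN /xnode /ynode -exprnP.
by field; rewrite !expf_neq0 ?y_neq0.
Qed.

Lemma xnode_inj a (j l : nat) : (j <= r)%N -> (l <= r)%N ->
  xnode a j = xnode a l -> j = l.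
Proof.
move=> jr lr E; apply/eqP/contraT => neq.
have: 1 - q ^ ((a j)%:Z - (a l)%:Z) * (y l / y j) != 0.
  by apply: qpochV_factor_neq0 => // /eqP; rewrite (negPf neq).
by rewrite xnode_div // E mulfV ?xnode_neq0 // subrr eqxx.
Qed.

Lemma ynode_inj p (j l : nat) : (j <= r)%N -> (l <= r)%N ->
  ynode p j = ynode p l -> j = l.
Proof.
move=> jr lr E; apply: (@xnode_inj p) => //; apply: invr_inj.
by rewrite /xnode !invf_div.
Qed.

Lemma Kden_addr m a p (i : 'I_m.+2) : (m < r)%N ->
  Kden m a (addrow p i) =
  (\prod_(j < m.+1) (1 - ynode p i * xnode a j)) * Kden m a p.
Proof.
move=> mr; rewrite -big_split /=; apply: eq_bigr => j _.
have -> : 1 - ynode p i * xnode a j =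
    \prod_(l < m.+2) if l == i then 1 - ynode p l * xnode a j else 1.
  by rewrite -big_mkcond /= big_pred1_eq.
rewrite -big_split /=; apply: eq_bigr => l _.
rewrite -node_qpow -qpochV_bool; last 2 first.
- have := ltn_ord j; lia.
- have := ltn_ord l; lia.
by congr qpochV; rewrite /addrow PoszD opprD addrA.
Qed.

Lemma Kden_addl m a p (i : 'I_m.+1) : (m < r)%N ->
  Kden m a p =
  (\prod_(l < m.+2) (1 - ynode p l * xnode (addrow a i) i)) * Kden m (addrow a i) p.
Proof.
move=> mr.
have -> : \prod_(l < m.+2) (1 - ynode p l * xnode (addrow a i) i) =
    \prod_(j < m.+1) \prod_(l < m.+2)
      (if j == i then 1 - ynode p l * xnode (addrow a i) j else 1).
  rewrite (bigD1 i) //= eqxx [X in _ * X]big1 ?mulr1 // => j /negPf ->.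
  by rewrite big1.
rewrite -big_split /=; apply: eq_bigr => j _.
rewrite -big_split /=; apply: eq_bigr => l _.
rewrite -node_qpow -qpochV_bool; last 2 first.
- have := ltn_ord j; lia.
- have := ltn_ord l; lia.
by congr qpochV; rewrite /addrow PoszD addrAC addrK.
Qed.

Definition Ccoef m p (i : 'I_m.+1) : F :=
  \prod_(j < m.+1 | j != i) (1 - ynode p i / ynode p j)^-1.

(** Passing from a to b = a + e_i changes two families of factors: those with first index i, whose
    exponent grows by 1, yield the 1 - x_i / x_l at b; those with second index i, whose exponent
    drops by 1, yield the 1 - Y_i / Y_j at a, because x_j / x_i = Y_i / Y_j. *)
Lemma Knum_addl m a (i : 'I_m.+1) : (m < r)%N ->
  Knum m a * Ccoef a i =
  Knum m (addrow a i) /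
    (\prod_(l < m.+1 | l != i) (1 - xnode (addrow a i) i / xnode (addrow a i) l)).
Proof.
move=> mr; set b := addrow a i.
have le_r (j : 'I_m.+1) : (j <= r)%N by have := ltn_ord j; lia.
have nzx (j l : 'I_m.+1) : j != l -> 1 - xnode b j / xnode b l != 0.
  move=> neq; rewrite -(xnode_div b (le_r j) (le_r l)).
  apply: (qpochV_factor_neq0 (le_r j) (le_r l)) => /val_inj/eqP.
  by rewrite (negPf neq).
have nzy (j : 'I_m.+1) : j != i -> 1 - ynode a i / ynode a j != 0.
  move=> neq; rewrite subr_eq0 -(inj_eq (mulIf (ynode_neq0 a (le_r j)))).
  rewrite mul1r mulfVK ?ynode_neq0 //; apply/negP => /eqP/ynode_inj.
  by move=> /(_ (le_r j) (le_r i))/val_inj/eqP; rewrite (negPf neq).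
have -> : Ccoef a i = (\prod_(j < m.+1) \prod_(l < m.+1 | l != j)
    (if l == i then 1 - ynode a i / ynode a j else 1))^-1.
  rewrite -prodfV [RHS](bigD1 i) //= [X in X^-1 * _]big1 => [|l /negPf->//].
  rewrite invr1 mul1r; apply: eq_bigr => j neq_ji; rewrite -prodfV.
  by rewrite (bigD1 i) 1?eq_sym //= eqxx big1 ?mulr1 // => l /andP[_ /negPf->]; rewrite invr1.
have -> : \prod_(l < m.+1 | l != i) (1 - xnode b i / xnode b l) =
  \prod_(j < m.+1) \prod_(l < m.+1 | l != j)
    (if j == i then 1 - xnode b j / xnode b l else 1).
  rewrite [RHS](bigD1 i) //= eqxx [X in _ * X]big1 ?mulr1 // => j /negPf ->.
  by rewrite big1.
rewrite -!prodfV -!big_split /=; apply: eq_bigr => j _.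
rewrite -!prodfV -!big_split /=; apply: eq_bigr => l neq_lj.
have bE k : (b k = a k + (k == i))%N by [].
have neq_jl : j != l by rewrite eq_sym.
case: (j =P i) => [Ej|/eqP neq_ji].
  have -> : (l == i) = false by rewrite -Ej; exact: negPf.
  rewrite invr1 mulr1 -invfM; congr (_^-1).
  rewrite -(xnode_div b (le_r j) (le_r l)) [RHS]mulrC -(qpochV_bool _ true (le_r j) (le_r l)).
  congr qpochV; rewrite !bE Ej eqxx.
  have nli : (l == i :> nat) = false by rewrite -Ej; exact: negPf neq_lj.
  by rewrite nli; lia.
rewrite invr1 mulr1; case: (l =P i) => [El|/eqP neq_li]; last first.
  rewrite invr1 mulr1; congr (qpochV _ _)^-1; rewrite !bE.
  have nli : (l == i :> nat) = false by exact: negPf neq_li.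
  have nji : (j == i :> nat) = false by exact: negPf neq_ji.
  by rewrite nli nji !addn0.
rewrite -invfM; congr (_^-1).
have -> : 1 - ynode a i / ynode a j =
    1 - q ^ ((a j)%:Z - (a l)%:Z) * (y l / y j).
  rewrite (xnode_div a (le_r j) (le_r l)) El /xnode /ynode !invf_div.
  by rewrite [X in 1 - X]mulrC.
rewrite mulrC -(qpochV_bool _ true (le_r j) (le_r l)); congr qpochV.
have nji : (j == i :> nat) = false by exact: negPf neq_ji.
by rewrite !bE El eqxx nji; lia.
Qed.

(** Only [Kden] depends on p, and p |-> p + e_i multiplies it by g(Y_i) with g = \prod_j (1 - x_j
    X). As g has one factor fewer than there are nodes Y_i, interpolation at 0 applies to it, and
    g(0) = 1. *)
Lemma Fsum_shift B m d p : (m <= r)%N ->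
  Fsum B m d p = \sum_(i < m.+1) Ccoef p i * Fsum B m d (addrow p i).
Proof.
case: m => [|m] mr.
  rewrite big_ord1 /= mulr1 /Ccoef big1 // => j.
  by rewrite (ord1 j).
rewrite /=; under [X in _ = X]eq_bigr => i _ do rewrite mulr_sumr.
rewrite exchange_big /=; apply: eq_bigr => a _.
have le_r (j : 'I_m.+2) : (j <= r)%N by have := ltn_ord j; lia.
have le_r' (j : 'I_m.+1) : (j <= r)%N by have := ltn_ord j; lia.
under eq_bigr do rewrite Kden_addr //.
set N := Knum _ _; set D := Kden _ _ _; set G := Fsum _ _ _ _.
pose g : {poly F} := \prod_(j < m.+1) (1 - (xnode (rowf a) j) *: 'X).
have gE z : g.[z] = \prod_(j < m.+1) (1 - z * xnode (rowf a) j).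
  by rewrite horner_prod; apply: eq_bigr => j _; move: (xnode _ _) => w; rewrite !hornerE; ring.
have size_g : (size g <= m.+2)%N.
  rewrite (leq_trans (size_poly_prod_leq _ _)) // card_ord.
  have : (\sum_(j < m.+1) size (1 - xnode (rowf a) j *: 'X)%R
            <= \sum_(j < m.+1) 2)%N.
    apply: leq_sum => j _; rewrite (leq_trans (size_polyD _ _)) // geq_max.
    by rewrite size_poly1 size_polyN (leq_trans (size_scale_leq _ _)) ?size_polyX.
  rewrite sum_nat_const card_ord leq_subLR => H.
  by apply: (@leq_trans (m.+1 * 2).+1); [exact: H|lia].
have u_inj : injective (fun i : 'I_m.+2 => ynode p i).
  by move=> i j /(ynode_inj (le_r i) (le_r j))/val_inj.
have := interpolation_at0 u_inj (fun i => ynode_neq0 p (le_r i)) size_g.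
rewrite gE [X in _ = X]big1 => [H|j _]; last by rewrite mul0r subr0.
transitivity ((N * D * G) * 1); first by rewrite mulr1.
rewrite -[1 in LHS]H mulr_sumr; apply: eq_bigr => i _.
by rewrite gE /Ccoef prodfV; ring.
Qed.

Lemma rowfE B (a : {ffun 'I_r.+1 -> 'I_B.+1}) (j : 'I_r.+1) : rowf a j = a j.
Proof. by rewrite /rowf valK. Qed.

Lemma rowf_out B (a : {ffun 'I_r.+1 -> 'I_B.+1}) j : (r < j)%N -> rowf a j = 0%N.
Proof. by move=> lt_rj; rewrite /rowf insubN // -leqNgt. Qed.

Lemma supportedP B m (a : {ffun 'I_r.+1 -> 'I_B.+1}) :
  reflect (forall j, (m <= j)%N -> rowf a j = 0%N) (supported m a).
Proof.
apply: (iffP forallP) => [H j mj|H j]; last first.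
  by apply/implyP => mj; rewrite -rowfE H.
case: (leqP j r) => [jr|/rowf_out//].
by have /implyP/(_ mj)/eqP := H (Ordinal (jr : (j < r.+1)%N)); rewrite -rowfE.
Qed.

Lemma rowf_inj B (a b : {ffun 'I_r.+1 -> 'I_B.+1}) : rowf a =1 rowf b -> a = b.
Proof. by move=> E; apply/ffunP => j; apply: ord_inj; rewrite -!rowfE. Qed.

Definition incr B (i : nat) (a : {ffun 'I_r.+1 -> 'I_B.+1}) : {ffun 'I_r.+1 -> 'I_B.+1} :=
  [ffun j : 'I_r.+1 => inord (a j + (j == i :> nat))].
Definition decr B (i : nat) (a : {ffun 'I_r.+1 -> 'I_B.+1}) : {ffun 'I_r.+1 -> 'I_B.+1} :=
  [ffun j : 'I_r.+1 => inord (a j - (j == i :> nat))].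

Lemma rowf_decr B i (a : {ffun 'I_r.+1 -> 'I_B.+1}) j :
  rowf (decr i a) j = (rowf a j - (j == i))%N.
Proof.
case: (leqP j r) => [jr|lt_rj]; last by rewrite !rowf_out.
pose j' := Ordinal (jr : (j < r.+1)%N).
have E (b : {ffun 'I_r.+1 -> 'I_B.+1}) : rowf b j = b j' := rowfE b j'.
by rewrite !E ffunE inordK // ltnS (leq_trans (leq_subr _ _)) // -ltnS.
Qed.

Lemma rowf_incr B i (a : {ffun 'I_r.+1 -> 'I_B.+1}) j : (i <= r)%N -> (rowf a i < B)%N ->
  rowf (incr i a) j = addrow (rowf a) i j.
Proof.
move=> ir aiB; rewrite /addrow.
case: (leqP j r) => [jr|lt_rj]; last first.
  by rewrite !rowf_out // gtn_eqF // (leq_ltn_trans ir).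
pose j' := Ordinal (jr : (j < r.+1)%N).
have E (b : {ffun 'I_r.+1 -> 'I_B.+1}) : rowf b j = b j' := rowfE b j'.
rewrite !E ffunE -E inordK //= ltnS; case: eqP => [->|_]; first by rewrite addn1.
by rewrite addn0 E -ltnS.
Qed.

Lemma sum_addrow m f (i : 'I_m.+1) :
  (\sum_(j < m.+1) addrow f i j = (\sum_(j < m.+1) f j).+1)%N.
Proof.
rewrite big_split /= -[RHS]addn1; congr addn.
rewrite (bigD1 i) //= eqxx big1 // => j neq_ji.
by have -> : (j == i :> nat) = false := negPf neq_ji.
Qed.

(** The map a |-> a + e_i is a bijection onto the rows of sum [d m] whose entry i is positive, and
    [T] vanishes on the other ones. The bound [d m <= B] ensures that [incr] does not leave the
    range of the entries. *)
Lemma sum_rows_shift B m (d : nat -> int) (i : 'I_m.+1) (T : (nat -> nat) -> F) :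
  (m < r)%N -> d m <= B%:Z ->
  (forall a : {ffun 'I_r.+1 -> 'I_B.+1}, rowf a i = 0%N -> T (rowf a) = 0) ->
  \sum_(a : {ffun 'I_r.+1 -> 'I_B.+1} |
      supported m.+1 a && ((\sum_(j < m.+1) rowf a j)%N%:Z == d m - 1))
     T (addrow (rowf a) i)
  = \sum_(a : {ffun 'I_r.+1 -> 'I_B.+1} |
      supported m.+1 a && ((\sum_(j < m.+1) rowf a j)%N%:Z == d m)) T (rowf a).
Proof.
move=> mr dB T0.
have ir : (i <= r)%N by have := ltn_ord i; lia.
rewrite [RHS](bigID (fun a : {ffun 'I_r.+1 -> 'I_B.+1} => (0 < rowf a i)%N)) /=.
rewrite [X in _ = _ + X]big1 ?addr0; last first.
  by move=> a /andP[_]; rewrite -eqn0Ngt => /eqP; exact: T0.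
have incrP (a : {ffun 'I_r.+1 -> 'I_B.+1}) : supported m.+1 a ->
    (\sum_(j < m.+1) rowf a j)%N%:Z = d m - 1 ->
    rowf (incr i a) =1 addrow (rowf a) i.
  move=> _ Ed j; apply: rowf_incr => //.
  suff : (rowf a i <= \sum_(j < m.+1) rowf a j)%N by lia.
  by rewrite (bigD1 i) //= leq_addr.
rewrite [RHS](reindex_onto (incr i) (decr i)); last first.
  move=> a /andP[/andP[_ /eqP Ed] ai]; apply: rowf_inj => j.
  rewrite rowf_incr //; first by rewrite /addrow rowf_decr subnK //; case: eqP => [->|].
  rewrite rowf_decr eqxx subn1.
  suff : ((rowf a i)%:Z <= d m) by move: dB ai; lia.
  by rewrite -Ed lez_nat (bigD1 i) //= leq_addr.
apply: eq_big => [a|a /andP[sa /eqP da]]; last first.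
  by congr T; apply/funext => j; rewrite incrP.
apply/idP/idP => [/andP[sa /eqP da]|/andP[/andP[/andP[sa /eqP da] ai] /eqP Ea]].
  have E := incrP a sa da.
  apply/andP; split; last first.
    by apply/eqP/rowf_inj => j; rewrite rowf_decr E /addrow addnK.
  rewrite E /addrow eqxx addn1 /= andbT; apply/andP; split; last first.
    by under eq_bigr do rewrite E; rewrite sum_addrow -addn1 PoszD da subrK.
  apply/supportedP => j mj; rewrite E /addrow (supportedP _ _ sa) // gtn_eqF //.
  by have := ltn_ord i; lia.
have E j : rowf (incr i a) j = addrow (rowf a) i j.
  rewrite -[in RHS]Ea /addrow rowf_decr subnK //.
  by case: eqP => [->|].
apply/andP; split.
  apply/supportedP => j mj; have := supportedP _ _ sa j mj.
  by rewrite E /addrow => /eqP; rewrite addn_eq0 => /andP[/eqP].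
have -> : d m = (\sum_(j < m.+1) addrow (rowf a) i j)%N.
  by rewrite -da; congr Posz; apply: eq_bigr => j _; exact: E.
by rewrite sum_addrow intS addrAC subrr add0r.
Qed.

(** Expanding each F_m(d; a) by [Fsum_shift] and taking b = a + e_i as the new index turns this sum
    into one over the same rows as F_(m+1)(d; p). Then [Knum_addl] and [Kden_addl] express the
    coefficient of F_m(d; b) through b alone. *)
Lemma Fsum_pred B m (d : nat -> int) p : (m < r)%N -> d m <= B%:Z ->
  Fsum B m.+1 (fun k => d k - (k == m)%:Z) p =
  \sum_(a : {ffun 'I_r.+1 -> 'I_B.+1} |
      supported m.+1 a && ((\sum_(j < m.+1) rowf a j)%N%:Z == d m))
     Knum m (rowf a) * Kden m (rowf a) p * Fsum B m d (rowf a) *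
     \sum_(i < m.+1) (\prod_(l < m.+2) (1 - ynode p l * xnode (rowf a) i)) /
        (\prod_(l < m.+1 | l != i) (1 - xnode (rowf a) i / xnode (rowf a) l)).
Proof.
move=> mr dB.
pose T (i : 'I_m.+1) b := Knum m b /
    (\prod_(l < m.+1 | l != i) (1 - xnode b i / xnode b l)) *
    ((\prod_(l < m.+2) (1 - ynode p l * xnode b i)) * Kden m b p) * Fsum B m d b.
transitivity (\sum_(i < m.+1) \sum_(a : {ffun 'I_r.+1 -> 'I_B.+1} |
      supported m.+1 a && ((\sum_(j < m.+1) rowf a j)%N%:Z == d m)) T i (rowf a)).
  rewrite /= eqxx.
  transitivity (\sum_(i < m.+1) \sum_(a : {ffun 'I_r.+1 -> 'I_B.+1} |
      supported m.+1 a && ((\sum_(j < m.+1) rowf a j)%N%:Z == d m - 1))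
        T i (addrow (rowf a) i)).
    rewrite exchange_big /=; apply: eq_bigr => a _.
    rewrite (@eq_Fsum B m _ d _ (rowf a)) //; last first.
      by move=> k km; rewrite (_ : (k == m) = false) ?subr0 //; lia.
    rewrite (Fsum_shift _ _ _ (ltnW mr)) mulr_sumr; apply: eq_bigr => i _.
    by rewrite /T -Knum_addl // -Kden_addl //; ring.
  apply: eq_bigr => i _; apply: sum_rows_shift => // a ai0.
  rewrite /T; suff -> : (\prod_(l < m.+2) (1 - ynode p l * xnode (rowf a) i)) *
      Kden m (rowf a) p = 0 by rewrite mulr0 mul0r.
  have ir : (i <= r)%N by have := ltn_ord i; lia.
  have lt_im : (i < m.+2)%N by rewrite ltnS ltnW // ltn_ord.
  pose i' := Ordinal lt_im.
  (* A row b with b_i = 0 is not of the form a + e_i. Its term is 0: either p_i = 0 and 1 - Y_i x_i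
     = 0, or p_i > b_i and [Kden] vanishes. *)
  case: (posnP (p i)) => [pi0|pi_gt0].
    rewrite (bigD1 i') //= /ynode /xnode ai0 pi0 !expr0 divr1 mul1r.
    by rewrite mulfV ?y_neq0 // subrr !mul0r.
  by rewrite (@Kden_eq0 _ _ _ i) ?mulr0 ?ai0 ?y_neq0 // -ltnS.
rewrite exchange_big /=; apply: eq_bigr => a _; rewrite mulr_sumr.
by apply: eq_bigr => i _; rewrite /T; ring.
Qed.

(** In the term indexed by a row a, the summands other than the last act on F_m(d; a) alone and give
    X = \sum_k x_k by induction. The last one adds e (1 - S), with S the sum in [Fsum_pred], and X +
    e (1 - S) is the eigenvalue for p by [interpolation_sum]. *)
Lemma Fsum_toda B m (d : nat -> int) (p : nat -> nat) :
  (m <= r)%N -> (forall k, (k < m)%N -> d k <= B%:Z) ->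
  d m = (\sum_(j < m.+1) p j)%N%:Z ->
  (y 0)^-1 * q ^ d 0 * Fsum B m d p +
  \sum_(k < m) (y k.+1)^-1 * q ^ (d k.+1 - d k) *
     (Fsum B m d p - Fsum B m (fun i => d i - (i == k)%:Z) p)
  = (\sum_(k < m.+1) xnode p k) * Fsum B m d p.
Proof.
elim: m p => [|m IHm] p mr dB dm.
  by rewrite /= big_ord0 addr0 !big_ord1 dm big_ord1 !mulr1 /xnode mulrC.
have le_r (j : 'I_m.+2) : (j <= r)%N by have := ltn_ord j; lia.
have le_r' (j : 'I_m.+1) : (j <= r)%N by have := ltn_ord j; lia.
pose P (a : {ffun 'I_r.+1 -> 'I_B.+1}) :=
  supported m.+1 a && ((\sum_(j < m.+1) rowf a j)%N%:Z == d m).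
pose K (a : {ffun 'I_r.+1 -> 'I_B.+1}) := Knum m (rowf a) * Kden m (rowf a) p.
have FE : Fsum B m.+1 d p = \sum_(a | P a) K a * Fsum B m d (rowf a) by [].
have FkE (k : 'I_m) : Fsum B m.+1 (fun i => d i - (i == k)%:Z) p =
    \sum_(a | P a) K a * Fsum B m (fun i => d i - (i == k)%:Z) (rowf a).
  by rewrite /= (_ : (m == k) = false) ?subr0 //; have := ltn_ord k; lia.
have := @Fsum_pred B m d p mr (dB m (leqnn _)).
set Fp := Fsum B m.+1 (fun k => d k - (k == m)%:Z) p => FpE.
pose e := (y m.+1)^-1 * q ^ (d m.+1 - d m).
rewrite big_ord_recr addrA.
suff : (y 0)^-1 * q ^ d 0 * Fsum B m.+1 d p +
    \sum_(k < m) (y k.+1)^-1 * q ^ (d k.+1 - d k) *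
     (Fsum B m.+1 d p - Fsum B m.+1 (fun i => d i - (i == k)%:Z) p)
  = \sum_(a | P a) K a * ((\sum_(k < m.+1) xnode (rowf a) k) * Fsum B m d (rowf a)).
  move=> E; transitivity (\sum_(a | P a) K a * ((\sum_(k < m.+1) xnode (rowf a) k) *
      Fsum B m d (rowf a)) + e * (Fsum B m.+1 d p - Fp)).
    by rewrite -E.
  rewrite FpE FE -sumrB !mulr_sumr -big_split /=; apply: eq_bigr => a /andP[_ /eqP Pa].
  (* As a and p have sums [d m] and [d m.+1], the coefficient of the last summand is exactly the
     normalization required by [interpolation_sum]. *)
  have eE : e = (\prod_(i < m.+1) xnode (rowf a) i * \prod_(l < m.+2) ynode p l)^-1.
    have qs s (f : nat -> nat) : \prod_(j < s) q ^+ f j = q ^+ (\sum_(j < s) f j)%N.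
      by elim/big_rec2: _ => [|j x1 x2 _ ->]; rewrite ?expr0 ?exprD.
    rewrite /xnode /ynode [X in _ * X]big_ord_recr /= !big_split /= !prodfV.
    rewrite /e dm -Pa expfzDr // -exprnN -exprnP -!qs big_ord_recr /=.
    have := y_neq0 mr; set Y := \prod_(i < m.+1) y i.
    have Y0 : Y != 0 by apply/prodf_neq0 => i _; exact: y_neq0.
    have Q0 (f : nat -> nat) s : \prod_(j < s) q ^+ f j != 0.
      by apply/prodf_neq0 => i _; exact: expf_neq0.
    move=> y0; field.
    by rewrite y0 Y0 !Q0 expf_neq0.
  have x_inj : injective (fun i : 'I_m.+1 => xnode (rowf a) i).
    by move=> i j /(xnode_inj (le_r' i) (le_r' j))/val_inj.
  have := interpolation_sum x_inj (fun i => xnode_neq0 _ (le_r' i))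
    (fun l => ynode_neq0 p (le_r l)).
  rewrite -eE; set S := \sum_(i < m.+1) _ / _ => H.
  have -> : \sum_(k < m.+2) xnode p k = \sum_(l < m.+2) (ynode p l)^-1.
    by apply: eq_bigr => l _; rewrite /ynode invf_div.
  set X := \sum_(i < m.+1) _ in H *; set Z := \sum_(i < m.+2) _ in H *.
  have -> : X = Z + e * (S - 1) by rewrite H; ring.
  by rewrite -/(K a); ring.
under [X in _ + X]eq_bigr => k _.
  rewrite FkE FE -sumrB mulr_sumr; over.
rewrite FE exchange_big /= mulr_sumr -big_split /=; apply: eq_bigr => a /andP[_ /eqP Pa].
rewrite -IHm; [|exact: ltnW|by move=> k km; exact: dB (leqW km)|exact: esym].
rewrite [RHS]mulrDr mulr_sumr; congr (_ + _); first by ring.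
by apply: eq_bigr => k _; ring.
Qed.
End FermionicSum.

(** * The product over the free coordinates of one pair (j, l) *)

Section FreeProduct.
Variables (F : fieldType) (q A : F).
Hypothesis q_neq0 : q != 0.
Local Notation ip := (qpochV q A).
Local Notation factor e := (1 - q ^ e * A).

Lemma qpochV0 : ip 0 = 1. Proof. by rewrite /= big_ord0. Qed.

Lemma prod_factorV (a b : nat) (M : int) : (a <= b)%N ->
  (forall c, (a <= c < b)%N -> factor (M - c%:Z) != 0) ->
  (\prod_(a <= c < b) (factor (M - c%:Z))^-1) * ip (M - b%:Z) = ip (M - a%:Z).
Proof.
move=> ab; rewrite -(subnKC ab); elim: (b - a)%N => [|n IHn] nz.
  by rewrite addn0 big_geq // mul1r.
rewrite addnS big_nat_recr ?leq_addr //= -IHn => [|c /andP[ac cb]]; last first.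
  by apply: nz; rewrite ac addnS ltnW.
rewrite -mulrA; congr (_ * _).
have nz' : factor (M - (a + n)%N%:Z) != 0 by apply: nz; rewrite leq_addr addnS ltnSn.
have -> : M - (a + n).+1%:Z = M - (a + n)%N%:Z - 1 by lia.
by rewrite qpochVB // mulKf.
Qed.

Lemma qpochV_split (m : int) :
  ip m = ip (Num.max m 0) * ip (Num.min m 0).
Proof.
by case: (leP 0 m) => _; rewrite qpochV0 ?mulr1 ?mul1r.
Qed.

Variables (r N j l : nat) (M L : nat -> nat).
Hypothesis lr : (l <= r)%N.
Hypothesis M_anti : forall k, (j <= k)%N -> (k.+1 < r)%N -> (M k.+1 <= M k)%N.
Hypothesis L_anti : forall k, (l <= k < r)%N -> (L k.+1 <= L k)%N.
Hypothesis L_r : L r = 0%N.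
Hypothesis M_lt : forall k, (M k <= N)%N.
Hypothesis L_lt : forall k, (L k <= N)%N.
Hypothesis factor_neq0 : forall e : int, (l = j -> 0 < e) -> factor e != 0.
Hypothesis LM : l = j -> L =1 M.

(** This is [free_coord] for a fixed pair (j, l), with M and L standing for the columns j and l of
    D, and A for y_l / y_j. *)
Definition free_step (k c : nat) : bool :=
  (j <= k)%N &&
  if (l <= j)%N || (c < M k)%N then
    [&& (l <= k)%N ==> (c < L k)%N, (l <= k.+1)%N & (L k.+1 <= c)%N]
  else [&& (l <= k)%N, (c < L k)%N & (L k + M k <= c + M k.-1)%N].

Lemma qpochV_neq0 (m : int) : (l = j -> 0 <= m) -> ip m != 0.
Proof.
case: m => k /= Hk; apply/prodf_neq0 => i _.
  by rewrite invr_neq0 // -[q ^+ _]/(q ^ i.+1%:Z); exact: factor_neq0.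
by rewrite exprnN; apply: factor_neq0 => /Hk.
Qed.

Lemma prod_range (a b : nat) (e : int) : (a <= b)%N -> (b <= N)%N -> (l = j -> b%:Z <= e) ->
  \prod_(c < N | (a <= c < b)%N) (factor (e - c%:Z))^-1 = ip (e - a%:Z) / ip (e - b%:Z).
Proof.
move=> ab bN eb.
have -> : \prod_(c < N | (a <= c < b)%N) (factor (e - c%:Z))^-1 =
    \prod_(a <= c < b) (factor (e - c%:Z))^-1.
  rewrite big_geq_mkord.
  by rewrite (big_ord_widen_cond N (leq a) (fun c : nat => (factor (e - c%:Z))^-1)).
rewrite -(@prod_factorV a b e ab) => [|c /andP[_ cb]]; last first.
  by apply: factor_neq0 => /eb; lia.
by rewrite mulfK // qpochV_neq0 // => /eb; lia.
Qed.

(** For l <= j the free c at k form the interval from L (k + 1) to L k, and the identity holds row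
    by row. For j < l, the c < M k give the positive parts of the indices M k - L (k + 1) and M k -
    L k; the c >= M k give the negative parts of M (k - 1) - L k and M k - L k. The numerators of
    the second kind thus belong to the preceding row. *)
Lemma free_prod :
  \prod_(k < r) \prod_(c < N | free_step k c) (factor ((M k)%:Z - c%:Z))^-1 =
  \prod_(k < r | (j <= k)%N)
    ((if (l <= k.+1)%N then ip ((M k)%:Z - (L k.+1)%:Z) else 1) *
     (if (l <= k)%N && (l != j) then (ip ((M k)%:Z - (L k)%:Z))^-1 else 1)).
Proof.
case: (leqP l j) => [lj|jl].
  rewrite [RHS]big_mkcond; apply: eq_bigr => k _ /=.
  have lt_kr := ltn_ord k.
  case: (leqP j k) => [jk|kj]; last first.
    by rewrite big_pred0 // => c; rewrite /free_step leqNgt kj.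
  have lk := leq_trans lj jk; rewrite lk (leqW lk) /=.
  have LL : (L k.+1 <= L k)%N by apply: L_anti; rewrite lk.
  transitivity (\prod_(c < N | (L k.+1 <= c < L k)%N) (factor ((M k)%:Z - c%:Z))^-1).
    by apply: eq_bigl => c; rewrite /free_step jk lj lk (leqW lk) /= andbC.
  rewrite prod_range //; last by move=> /LM ->.
  case: eqP => [/LM E|_] //=; by rewrite (E k) subrr qpochV0 divr1 mulr1.
pose Pp (m : int) := ip (Num.max m 0); pose Pm (m : int) := ip (Num.min m 0).
(* [h] records this displacement by one row. It is 1 at k = 0, because l > j, and at k = r, because
   L r = 0, so that it cancels in the product over all rows. *)
pose h k := if (l <= k)%N then Pm ((M k.-1)%:Z - (L k)%:Z) else 1.
have neq_lj : (l == j) = false by rewrite gtn_eqF.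
have neq (P : Prop) : l = j -> P by move=> E; rewrite E ltnn in jl.
have step (k : 'I_r) : \prod_(c < N | free_step k c) (factor ((M k)%:Z - c%:Z))^-1 * h k.+1 =
    (if (j <= k)%N then ((if (l <= k.+1)%N then ip ((M k)%:Z - (L k.+1)%:Z) else 1) *
     (if (l <= k)%N && (l != j) then (ip ((M k)%:Z - (L k)%:Z))^-1 else 1)) else 1) * h k.
  have lt_kr := ltn_ord k.
  rewrite neq_lj andbT /h /=; case: (leqP j k) => [jk|kj]; last first.
    rewrite big_pred0 => [|c]; last by rewrite /free_step leqNgt kj.
    by rewrite !ifF //; lia.
  rewrite (bigID (fun c : 'I_N => c < M k)%N) /=.
  have -> : \prod_(c < N | free_step k c && (c < M k)%N) (factor ((M k)%:Z - c%:Z))^-1 =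
      if (l <= k.+1)%N then Pp ((M k)%:Z - (L k.+1)%:Z) /
        (if (l <= k)%N then Pp ((M k)%:Z - (L k)%:Z) else 1) else 1.
    case: (leqP l k.+1) => [lk1|k1l]; last first.
      by rewrite big_pred0 // => c; rewrite /free_step; case: ifP; lia.
    case: (leqP l k) => [lk|kl].
      have LL : (L k.+1 <= L k)%N by apply: L_anti; rewrite lk.
      case: (leqP (L k.+1) (M k)) => [LM'|ML]; last first.
        rewrite big_pred0 => [|c]; last by rewrite /free_step; case: ifP; lia.
        by rewrite /Pp !max_r ?qpochV0 ?divr1 //; lia.
      transitivity (\prod_(c < N | (L k.+1 <= c < minn (L k) (M k))%N)
        (factor ((M k)%:Z - c%:Z))^-1).
        by apply: eq_bigl => c; rewrite /free_step; case: ifP; lia.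
      rewrite prod_range ?(neq _) //; last first.
      - exact: neq.
      - by rewrite geq_min L_lt.
      - by rewrite leq_min LL.
      by congr (ip _ / ip _); lia.
    rewrite divr1.
    case: (leqP (L k.+1) (M k)) => [LM'|ML]; last first.
      rewrite big_pred0 => [|c]; last by rewrite /free_step; case: ifP; lia.
      by rewrite /Pp max_r ?qpochV0 //; lia.
    transitivity (\prod_(c < N | (L k.+1 <= c < M k)%N) (factor ((M k)%:Z - c%:Z))^-1).
      by apply: eq_bigl => c; rewrite /free_step; case: ifP; lia.
    rewrite (prod_range LM' (M_lt k) (neq _)) subrr qpochV0 divr1.
    by rewrite /Pp max_l //; lia.
  have -> : \prod_(c < N | free_step k c && ~~ (c < M k)%N) (factor ((M k)%:Z - c%:Z))^-1 =
      if (l <= k)%N then Pm ((M k.-1)%:Z - (L k)%:Z) / Pm ((M k)%:Z - (L k)%:Z) else 1.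
    case: (leqP l k) => [lk|kl]; last first.
      by rewrite big_pred0 // => c; rewrite /free_step; case: ifP; lia.
    have MM : (M k <= M k.-1)%N.
      have := @M_anti k.-1; rewrite prednK; [apply; lia|lia].
    case: (leqP (L k) (M k)) => [LM'|ML].
      rewrite big_pred0 => [|c]; last by rewrite /free_step; case: ifP; lia.
      by rewrite /Pm !min_r ?divff ?qpochV0 ?oner_neq0 //; lia.
    transitivity (\prod_(c < N | (maxn (M k) (L k + M k - M k.-1) <= c < L k)%N)
        (factor ((M k)%:Z - c%:Z))^-1).
      by apply: eq_bigl => c; rewrite /free_step; case: ifP; lia.
    rewrite prod_range; last first.
    - exact: neq.
    - exact: L_lt.
    - by rewrite geq_max; lia.
    by congr (ip _ / ip _); lia.
  have Pn m : Pp m != 0 /\ Pm m != 0 by split; apply: qpochV_neq0; exact: neq.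
  have spl m : ip m = Pp m * Pm m by exact: qpochV_split.
  case: (leqP l k.+1) => [lk1|k1l]; last first.
    by rewrite !ifF //; lia.
  case: (leqP l k) => [lk|kl]; rewrite /= !spl ?divr1 ?mulr1 //.
  have [p1 p2] := Pn ((M k)%:Z - (L k)%:Z).
  by field; rewrite p1 p2.
have hh : \prod_(k < r) h k.+1 = \prod_(k < r) h k.
  have h0 : h 0%N = 1 by rewrite /h leqNgt (leq_ltn_trans _ jl).
  have hr : h r = 1 by rewrite /h lr L_r /Pm min_r ?qpochV0 //; lia.
  have := big_ord_recl r (fun k : 'I_r.+1 => h k) => /=.
  move=> /(_ _ _) E.
  transitivity (\prod_(k < r.+1) h k).
    by rewrite big_ord_recl /= h0 mul1r.
  by rewrite big_ord_recr /= hr mulr1.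
have hnz : \prod_(k < r) h k != 0.
  apply/prodf_neq0 => k _; rewrite /h; case: ifP => _; last exact: oner_neq0.
  by apply: qpochV_neq0; exact: neq.
apply: (mulIf hnz); rewrite -{1}hh -big_split /= [X in X * _]big_mkcond -big_split /=.
by apply: eq_bigr => k _; exact: step.
Qed.
End FreeProduct.

(** * Weights of the tangent space at a fixed point *)

Lemma prod_eq1_neq0 (F : fieldType) (I : finType) (f : I -> F) :
  \prod_i f i = 1 -> forall i, f i != 0.
Proof.
move=> f1 i; apply: contra_eq_neq f1 => fi0.
by rewrite (bigD1 i) //= fi0 mul0r eq_sym oner_neq0.
Qed.

Section PolyXn.
Variable F : fieldType.
Implicit Types p q : {poly F}.

Lemma dvdXn_drop n p : 'X^n %| p -> p = drop_poly n p * 'X^n.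
Proof. by case/dvdpP => q ->; rewrite drop_polyMXn_id. Qed.

Lemma dvdXnP n p : reflect (forall c, (c < n)%N -> p`_c = 0) ('X^n %| p).
Proof.
apply: (iffP idP) => [/dvdXn_drop -> c cn|H]; first by rewrite coefMXn cn.
rewrite -(poly_take_drop n p) (_ : take_poly n p = 0) ?add0r ?dvdp_mulIr //.
by apply/polyP => c; rewrite coef_take_poly coef0; case: ifP => // /H.
Qed.

Lemma drop_polyM n p q : 'X^n %| q -> drop_poly n (p * q) = p * drop_poly n q.
Proof. by move=> /dvdXn_drop {1}->; rewrite mulrA drop_polyMXn_id. Qed.
End PolyXn.

(** * Coordinates of tangent vectors and the relations between them *)

Section Tangent.
Variables (R : realType) (r : nat) (D : 'M[nat]_(r, r.+1)).
Local Notation C := R[i].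
Local Notation sect := 'rV[{poly C}]_r.+1.
Local Notation subsh := (subsheaf (R := R) D).
Implicit Types (k : 'I_r) (m : sect) (p : {poly C}).

Lemma subsheafP k m :
  subsh k m <-> (forall j : 'I_r.+1,
    if (j <= k)%N then is_true ('X^(D k j) %| m 0 j) else m 0 j = 0).
Proof.
by split=> H j; move: (H j); case: ifP => // _ /eqP.
Qed.

Lemma subsheaf0 k : subsh k 0.
Proof. by move=> j; rewrite mxE dvdp0 eqxx; case: ifP. Qed.

Lemma subsheafD k m m' : subsh k m -> subsh k m' -> subsh k (m + m').
Proof.
move=> Hm Hm' j; rewrite mxE; move: (Hm j) (Hm' j).
by case: ifP => _; [exact: dvdp_add | move=> /eqP-> /eqP->; rewrite addr0].
Qed.

Lemma subsheafZ k p m : subsh k m -> subsh k (p *: m).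
Proof.
move=> Hm j; rewrite mxE; move: (Hm j).
by case: ifP => _; [exact: dvdp_mull | move=> /eqP->; rewrite mulr0].
Qed.

Lemma subsheafN k m : subsh k m -> subsh k (- m).
Proof. by rewrite -scaleN1r; exact: subsheafZ. Qed.

Lemma subsheafB k m m' : subsh k m -> subsh k m' -> subsh k (m - m').
Proof. by move=> Hm Hm'; apply: subsheafD => //; exact: subsheafN. Qed.

Lemma subsheaf_sum k (I : finType) (f : I -> sect) :
  (forall i, subsh k (f i)) -> subsh k (\sum_i f i).
Proof.
move=> H; elim/big_ind: _ => // [|x y]; [exact: subsheaf0 | exact: subsheafD].
Qed.

Lemma subsheaf_addl k m m' : subsh k (m - m') -> subsh k m' -> subsh k m.
Proof. by move=> H H'; rewrite -(subrK m' m); exact: subsheafD. Qed.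

Lemma tangent_sum (I : finType) (c : I -> C) (e : I -> cochain R r) :
  (forall i, tangent_vector D (e i)) ->
  tangent_vector D (fun k m => \sum_i (c i)%:P *: e i k m).
Proof.
move=> He; split=> [k p m m' Hm Hm'|k m s Hm size_m j kj|k k' Ek m Hm].
- rewrite scaler_sumr -big_split -sumrB; apply: subsheaf_sum => i /=.
  have [lin _ _] := He i.
  rewrite scalerA mulrC -scalerA -scalerDr -scalerBr.
  by apply: subsheafZ; exact: lin.
- rewrite summxE (leq_trans (size_sum _ _ _)) //; apply/bigmax_leqP => i _.
  have [_ sz _] := He i.
  by rewrite mxE mul_polyC (leq_trans (size_scale_leq _ _)) // (sz k m s).
- rewrite -sumrB; apply: subsheaf_sum => i; rewrite -scalerBr.
  by apply: subsheafZ; have [_ _ comp] := He i; exact: comp.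
Qed.

Lemma tangentB (phi psi : cochain R r) : tangent_vector D phi -> tangent_vector D psi ->
  tangent_vector D (fun k m => phi k m - psi k m).
Proof.
move=> H1 H2.
have := @tangent_sum bool (fun b => if b then 1 else -1) (fun b => if b then phi else psi).
case=> [[]//|L S K].
have E k m : \sum_(b : bool) (if b then 1 else -1)%:P *: (if b then phi else psi) k m
   = phi k m - psi k m.
  by rewrite big_bool /= polyCN polyC1 scale1r scaleN1r.
split=> [k p m m' Hm Hm'|k m s Hm Hs|k k' Ek m Hm].
- by have := L k p m m' Hm Hm'; rewrite !E.
- by have := S k m s Hm Hs; rewrite E.
- by have := K k k' Ek m Hm; rewrite !E.
Qed.

Definition gen k (j : 'I_r.+1) : sect := 'X^(D k j) *: delta_mx 0 j.

Lemma genE k (j l : 'I_r.+1) : gen k j 0 l = if l == j then 'X^(D k j) else 0.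
Proof. by rewrite !mxE eqxx /=; case: eqP; rewrite ?mulr1 ?mulr0. Qed.

Lemma gen_subsheaf k (j : 'I_r.+1) : (j <= k)%N -> subsh k (gen k j).
Proof.
move=> jk l; rewrite genE; case: eqP => [->|_]; first by rewrite jk dvdpp.
by rewrite dvdp0 eqxx; case: ifP.
Qed.

Lemma gen_decomp k m : subsh k m ->
  m = \sum_(j : 'I_r.+1) (if (j <= k)%N then drop_poly (D k j) (m 0 j) else 0) *: gen k j.
Proof.
move=> /subsheafP Hm; apply/rowP => l; rewrite summxE (bigD1 l) //= big1.
  rewrite addr0 mxE genE eqxx; have := Hm l; case: ifP => [_ /dvdXn_drop //|_ ->].
  by rewrite mul0r.
by move=> j neq_jl; rewrite mxE genE eq_sym (negPf neq_jl) mulr0.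
Qed.

Lemma tangent_lin0 phi k : tangent_vector D phi -> subsh k (phi k 0).
Proof.
case=> lin _ _; have := lin k 1 0 0 (subsheaf0 k) (subsheaf0 k).
rewrite !scale1r addr0 opprD addrA subrr add0r => /subsheafN; by rewrite opprK.
Qed.

Lemma tangent_span phi k (I : finType) (p : I -> {poly C}) (g : I -> sect) :
  tangent_vector D phi ->
  (forall i, p i != 0 -> subsh k (g i) /\ subsh k (phi k (g i))) ->
  subsh k (phi k (\sum_i p i *: g i)).
Proof.
move=> T Hg; suff [] : subsh k (phi k (\sum_i p i *: g i)) /\ subsh k (\sum_i p i *: g i) by [].
elim/big_rec: _ => [|i m _ [H1 H2]]; first by split; [exact: tangent_lin0 | exact: subsheaf0].
case: (eqVneq (p i) 0) => [->|/Hg[Hi Hphi]]; first by rewrite scale0r add0r.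
split; last by apply: subsheafD => //; exact: subsheafZ.
have [lin _ _] := T; apply: subsheaf_addl (lin _ _ _ _ Hi H2) _.
by apply: subsheafD => //; exact: subsheafZ.
Qed.

Definition tcoord (phi : cochain R r) k (j l : 'I_r.+1) (c : nat) : C :=
  (phi k (gen k j) 0 l)`_c.

(** Modulo M_k, [phi k] is given by its values at the generators, whose coefficients with l <= k and
    c >= D k l already lie in M_k. *)
Lemma tangent_eq0 phi : tangent_vector D phi ->
  (forall k (j l : 'I_r.+1) c, (j <= k)%N -> ((l <= k)%N -> (c < D k l)%N) ->
     tcoord phi k j l c = 0) ->
  forall k m, subsh k m -> subsh k (phi k m).
Proof.
move=> T H k m Hm; rewrite (gen_decomp Hm); apply: tangent_span => // j.
case: ifP => [jk _|_ /eqP//]; split; first exact: gen_subsheaf.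
apply/subsheafP => l; case: ifP => [lk|/negbT nlk].
  by apply/dvdXnP => c cD; exact: H.
by apply/polyP => c; rewrite coef0; apply: H => // lk; rewrite lk in nlk.
Qed.

(* Row r stands for W (x) O itself, all of whose exponents are 0. *)
Definition Dext (k : nat) (l : 'I_r.+1) : nat :=
  if insub k is Some k' then D k' l else 0%N.

Lemma DextE k l : Dext k l = D k l.
Proof. by rewrite /Dext valK. Qed.

(* The coordinate (k, j, l, c) has weight t_l^2 t_j^-2 v^(2 (D k j - c)). For
   fixed j, l and weight, a tangent vector has at most one coordinate for each
   k; a compatibility condition between k and k + 1 determines the coordinate at
   k by the one at k + 1 for left_coord, and conversely otherwise. The free
   coordinates are those not determined in this way. *)
Definition left_coord k (j l : 'I_r.+1) (c : nat) : bool :=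
  (l <= j)%N || (c < D k j)%N.

Definition free_coord k (j l : 'I_r.+1) (c : nat) : bool :=
  (j <= k)%N &&
  if left_coord k j l c then
    [&& (l <= k)%N ==> (c < D k l)%N, (l <= k.+1)%N & (Dext k.+1 l <= c)%N]
  else [&& (l <= k)%N, (c < D k l)%N & (D k l + D k j <= c + Dext k.-1 j)%N].

Hypothesis D_mono : forall (i k : 'I_r) (j : 'I_r.+1),
  (j <= k <= i)%N -> (D i j <= D k j)%N.

(** The generator j of M_k is z^(D k j - D k' j) times that of M_k', hence the shift of c.
    Compatibility holds modulo M_k' only, hence the condition on c. *)
Lemma coord_link phi k k' (j l : 'I_r.+1) c : tangent_vector D phi -> k' = k.+1 :> nat ->
  (j <= k)%N -> ((l <= k')%N -> (c < D k' l)%N) ->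
  tcoord phi k j l c =
    if (c < D k j - D k' j)%N then 0 else tcoord phi k' j l (c - (D k j - D k' j)).
Proof.
move=> T Ek jk cl.
have DD : (D k' j <= D k j)%N by apply: D_mono; rewrite jk Ek leqnSn.
have jk' : (j <= k')%N by rewrite Ek leqW.
have gE : gen k j = 'X^(D k j - D k' j) *: gen k' j.
  by rewrite /gen scalerA -exprD subnK.
have [lin _ comp] := T.
have H1 := comp _ _ Ek _ (gen_subsheaf jk).
have H2 := lin k' 'X^(D k j - D k' j) (gen k' j) 0 (gen_subsheaf jk') (subsheaf0 k').
have H3 : subsh k' (phi k (gen k j) - 'X^(D k j - D k' j) *: phi k' (gen k' j)).
  move: H2; rewrite addr0 -gE => H2; set X := _ *: _ in H2 *.
  have -> : phi k (gen k j) - X = phi k' (gen k j) - (X + phi k' 0)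
      - (phi k' (gen k j) - phi k (gen k j)) + phi k' 0.
    by apply/rowP => i; rewrite !mxE; ring.
  by apply: subsheafD; [exact: subsheafB | exact: tangent_lin0].
have /subsheafP/(_ l) := H3; rewrite !mxE => H4.
have : (phi k (gen k j) 0 l - 'X^(D k j - D k' j) * phi k' (gen k' j) 0 l)`_c = 0.
  by case: ifP H4 => [lk /dvdXnP|_ ->]; [apply; exact: cl | rewrite coef0].
by rewrite coefB mulrC coefMXn => /subr0_eq.
Qed.

Lemma coord_size phi k (j l : 'I_r.+1) c : tangent_vector D phi ->
  (j <= k)%N -> (k < l)%N -> (D k j <= c)%N -> tcoord phi k j l c = 0.
Proof.
move=> [_ sz _] jk kl Dc; apply: nth_default; apply: leq_trans Dc.
apply: sz => // [|i]; first exact: gen_subsheaf.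
by rewrite genE; case: ifP => _; rewrite ?size_polyXn ?size_poly0.
Qed.

(** A left coordinate that is not free is 0 or equals a left coordinate of row k + 1; the process
    ends at the latest in row r - 1, where the condition on [Dext r l = 0] is trivial. Any other
    coordinate that is not free equals one of row k - 1 of the same kind; the process ends at the
    latest when k < l, where the condition at infinity makes it 0. *)
Lemma coord_free_eq0 phi : tangent_vector D phi ->
  (forall k (j l : 'I_r.+1) c, free_coord k j l c -> tcoord phi k j l c = 0) ->
  forall k m, subsh k m -> subsh k (phi k m).
Proof.
move=> T H; apply: tangent_eq0 => // k j l c.
case: (boolP (left_coord k j l c)) => left.
  elim: {k}(r - k)%N {-2}k (leqnn (r - k)) c left => [|n IHn] k kn c left jk cl.
    by move: kn; have := ltn_ord k; lia.
  case: (boolP (free_coord k j l c)) => [/H//|]; rewrite /free_coord jk left /=.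
  have -> /= : (l <= k)%N ==> (c < D k l)%N by apply/implyP.
  case: (ltnP k.+1 r) => [lt_kr|le_rk]; last first.
    have -> : (l <= k.+1)%N by have := ltn_ord l; lia.
    by rewrite /Dext insubN //= -leqNgt.
  pose k' := Ordinal lt_kr; rewrite -[k.+1]/(nat_of_ord k') DextE negb_and -!ltnNge => nfree.
  have cl' : (l <= k')%N -> (c < D k' l)%N by move=> lk; case/orP: nfree => //; move: lk => /=; lia.
  have DD : (D k' j <= D k j)%N by apply: D_mono; rewrite jk leqnSn.
  rewrite (coord_link (k' := k')) //; case: ifP => // /negbT; rewrite -leqNgt => Dc.
  apply: IHn => //; first by rewrite /=; lia.
  - by move: left; rewrite /left_coord; case: (l <= j)%N => //=; lia.
  - by rewrite /= leqW.
  - by move=> /cl'; apply: leq_ltn_trans; exact: leq_subr.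
elim: {k}(nat_of_ord k) {-2}k (leqnn k) c left => [|n IHn] k kn c left jk cl.
  move: left; rewrite /left_coord negb_or -ltnNge -leqNgt => /andP[jl Dc].
  by apply: coord_size => //; lia.
move: (left); rewrite /left_coord negb_or -ltnNge -leqNgt => /andP[jl Dc].
case: (ltnP k l) => [kl|lk]; first exact: coord_size.
case: (boolP (free_coord k j l c)) => [/H//|]; rewrite /free_coord jk (negPf left) lk cl //=.
have k_gt0 : (0 < k)%N by lia.
have lt_kr : (k.-1 < r)%N by have := ltn_ord k; lia.
pose k' := Ordinal lt_kr; rewrite -[k.-1]/(nat_of_ord k') DextE -ltnNge => nfree.
have Ek : k = k'.+1 :> nat by rewrite /= prednK.
have jk' : (j <= k')%N by rewrite /=; lia.
have DD : (D k j <= D k' j)%N by apply: D_mono; rewrite jk' /= leq_pred.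
have := @coord_link phi k' k j l (c + (D k' j - D k j)) T Ek jk'.
have -> : (c + (D k' j - D k j) < D k' j - D k j)%N = false by lia.
rewrite addnK => <-; last by move=> _; lia.
apply: IHn => //; first by rewrite /=; lia.
- by rewrite /left_coord negb_or -ltnNge jl -leqNgt; lia.
- move=> lk'; have : (D k l <= D k' l)%N by apply: D_mono; rewrite lk' /= leq_pred.
  by lia.
Qed.
End Tangent.

(** * A weight vector for each free coordinate *)

Section WeightBasis.
Variables (R : realType) (r : nat) (D : 'M[nat]_(r, r.+1)).
Local Notation C := R[i].
Local Notation sect := 'rV[{poly C}]_r.+1.
Local Notation subsh := (subsheaf (R := R) D).
Local Notation character := ({ffun 'I_r.+1 -> int} * int)%type.

(** The rows reached from [k0] by compatibility: left coordinates propagate to smaller k, the others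
    to larger k. *)
Definition active (k0 : 'I_r) (j l : 'I_r.+1) (c : nat) (k : 'I_r) : bool :=
  if left_coord D k0 j l c then (j <= k <= k0)%N else (k0 <= k)%N.

(** On active rows z^(D k j) w_j is sent to z^(D k j + c - D k0 j) w_l: the difference of the
    exponents is constant, so all rows have the same weight. For a free coordinate the subtraction
    is never truncated on an active row. *)
Definition basis_vector (k0 : 'I_r) (j l : 'I_r.+1) (c : nat) : cochain R r :=
  fun k m => if active k0 j l c k
    then (drop_poly (D k j) (m 0 j) * 'X^(D k j + c - D k0 j)) *: delta_mx 0 l else 0.

Lemma coord_basis_vector k0 j l c k j' l' c' :
  tcoord D (basis_vector k0 j l c) k j' l' c' =
  [&& active k0 j l c k, j' == j, l' == l & c' == (D k j + c - D k0 j)%N]%:R.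
Proof.
rewrite /tcoord /basis_vector; case: ifP => _; last by rewrite mxE coef0.
rewrite genE !mxE eqxx /= [j == j']eq_sym; case: eqVneq => [->|_] /=; last first.
  by rewrite linear0 mul0r mul0r coef0.
have -> : drop_poly (D k j) 'X^(D k j) = 1 :> {poly C}.
  by rewrite -[RHS](drop_polyMXn_id (D k j)) mul1r.
rewrite mul1r.
by case: eqVneq => _; rewrite ?mulr1 ?mulr0 ?coef0 // coefXn.
Qed.

Hypothesis D_mono : forall (i k : 'I_r) (j : 'I_r.+1),
  (j <= k <= i)%N -> (D i j <= D k j)%N.

(** Compatibility is in question only where activity changes. At [k0] the nonzero value has to lie
    in the larger subsheaf, which is the last inequality of [free_coord], with l <= k0 + 1 or l <=
    k0; at the lower end k = j of a left range, the preceding subsheaf has no component along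
    w_j. *)
Lemma basis_tangent k0 j l c : free_coord D k0 j l c ->
  tangent_vector D (basis_vector k0 j l c).
Proof.
rewrite /free_coord => /andP[jk0 F].
have act_j k : active k0 j l c k -> (j <= k)%N.
  rewrite /active; case: ifP F => _ _; first by case/andP.
  exact: leq_trans.
split=> [k p m m' Hm Hm'|k m s Hm size_m i ki|k k' Ek m Hm].
- rewrite /basis_vector; case: ifP => [/act_j jk|_]; last first.
    by rewrite scaler0 addr0 subrr; exact: subsheaf0.
  rewrite !mxE linearD /= drop_polyM; last by have := Hm j; rewrite jk.
  rewrite mulrDl scalerDl -mulrA -[in X in X + _ - _]scalerA subrr; exact: subsheaf0.
- rewrite /basis_vector; case: ifP => [act|_]; last by rewrite mxE size_poly0.
  rewrite !mxE eqxx /=; case: eqVneq => [Ei|_]; last by rewrite mulr0 size_poly0.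
  (* As k < l, the coordinate must be a left one, and j < l then forces c < D k0 j: this strict
     inequality is the drop in degree required at infinity. *)
  subst i; move: act F; rewrite /active.
  case: ifP => [left /andP[jk kk0] _|_ k0k /and3P[lk0 _ _]]; last by lia.
  move: left; rewrite /left_coord leqNgt (leq_ltn_trans jk ki) /= => cD.
  rewrite mulr1; set u := drop_poly _ _.
  have := size_drop_poly (D k j) (m 0 j); rewrite -/u.
  case: (eqVneq u 0) => [->|u0]; first by rewrite mul0r size_poly0.
  rewrite size_Mmonic ?monicXn // size_polyXn.
  have DD : (D k0 j <= D k j)%N by apply: D_mono; rewrite jk.
  have arith a b x y : (0 < a -> b <= s.+1 -> a = b - x -> c < y -> y <= x ->
    (a + (x + c - y).+1).-1 <= s)%N by lia.
  by rewrite -size_poly_gt0 in u0 => su; exact: arith u0 (size_m j) su cD DD.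
- have DD : (j <= k)%N -> (D k' j <= D k j)%N.
    by move=> jk; apply: D_mono; rewrite jk Ek leqnSn.
  have Em : (j <= k)%N -> m 0 j = drop_poly (D k j) (m 0 j) * 'X^(D k j).
    by move=> jk; apply: dvdXn_drop; have := Hm j; rewrite jk.
  have Ed : (j <= k)%N -> drop_poly (D k' j) (m 0 j) =
      drop_poly (D k j) (m 0 j) * 'X^(D k j - D k' j).
    by move=> jk; rewrite {1}Em // -(subnK (DD jk)) exprD mulrA drop_polyMXn_id subnK ?DD.
  rewrite /basis_vector; case: ifP => act'; case: ifP => act.
  + have jk := act_j _ act; rewrite Ed // -mulrA -exprD.
    have -> : (D k j - D k' j + (D k' j + c - D k0 j) = D k j + c - D k0 j)%N.
      move: act' F; rewrite /active; case: ifP => [_ /andP[jk' k'k0]|left k0k'] F.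
        have : (D k0 j <= D k' j)%N by apply: D_mono; rewrite jk'.
        by have := DD jk; lia.
      by move: left; rewrite /left_coord; have := DD jk; lia.
    by rewrite subrr; exact: subsheaf0.
  + rewrite subr0; case: (leqP j k) => [jk|kj]; last first.
      have -> : m 0 j = 0 by have /subsheafP/(_ j) := Hm; rewrite leqNgt kj.
      by rewrite linear0 mul0r scale0r; exact: subsheaf0.
    move: act act' F; rewrite /active; case: ifP => [left|left].
      by rewrite jk /= => kk0 /andP[_ k'k0]; lia.
    move=> k0k k0k' /and3P[lk0 cD F].
    have Ek0 : k' = k0 by apply/val_inj => /=; lia.
    subst k'; rewrite Ed // -mulrA -exprD.
    apply/subsheafP => i; rewrite !mxE eqxx /=; case: eqVneq => [->|_]; last first.
      by rewrite mulr0 dvdp0; case: ifP.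
    rewrite lk0 mulr1; apply: dvdp_mull; apply: dvdp_exp2l.
    by move: F; rewrite Ek /= DextE; have := DD jk; lia.
  + rewrite sub0r; apply: subsheafN.
    have jk := act_j _ act; move: act act' F; rewrite /active.
    case: ifP => [left|left]; last by lia.
    move=> /andP[_ kk0] nk' /and3P[_ lk1 F].
    have Ek0 : k = k0 by apply/val_inj => /=; lia.
    subst k; apply/subsheafP => i; rewrite !mxE eqxx /=.
    case: eqVneq => [->|_]; last by rewrite mulr0 dvdp0; case: ifP.
    rewrite Ek lk1 mulr1; apply: dvdp_mull; apply: dvdp_exp2l.
    by move: F; rewrite -Ek DextE; lia.
  + by rewrite subrr; exact: subsheaf0.
Qed.

Definition weight (k0 : 'I_r) (j l : 'I_r.+1) (c : nat) : character :=
  ([ffun i => ((i == l)%:Z - (i == j)%:Z) * 2], ((D k0 j)%:Z - c%:Z) * 2).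

Lemma char_val_weight k0 j l c (t : 'I_r.+1 -> C) v : in_torus t v ->
  char_val (weight k0 j l c) t v =
  t l ^+ 2 / t j ^+ 2 * v ^ (((D k0 j)%:Z - c%:Z) * 2).
Proof.
move=> [t1 v0]; rewrite /char_val /=; congr (_ * _).
have t0 := prod_eq1_neq0 t1.
transitivity (\prod_i ((if i == l then t i ^+ 2 else 1) * (if i == j then t i ^- 2 else 1))).
  apply: eq_bigr => i _; rewrite ffunE.
  case: (i == l); case: (i == j) => /=.
  - by rewrite subrr mul0r expr0z divff // expf_neq0.
  - by rewrite subr0 mul1r mulr1.
  - by rewrite sub0r mulN1r mul1r -exprnN.
  - by rewrite subrr mul0r expr0z mulr1.
by rewrite big_split /= -!big_mkcond /= !big_pred1_eq.
Qed.

Lemma basis_weight k0 j l c (t : 'I_r.+1 -> C) v : in_torus t v -> free_coord D k0 j l c ->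
  same_cochain D (torus_act t v (basis_vector k0 j l c))
    (fun k m => (char_val (weight k0 j l c) t v)%:P *: basis_vector k0 j l c k m).
Proof.
move=> tv F k m Hm; rewrite char_val_weight //; case: tv => t1 v0.
suff -> : torus_act t v (basis_vector k0 j l c) k m =
  (t l ^+ 2 / t j ^+ 2 * v ^ (((D k0 j)%:Z - c%:Z) * 2))%:P *: basis_vector k0 j l c k m.
  by rewrite subrr; exact: subsheaf0.
rewrite /torus_act /basis_vector; case: ifP => act; last first.
  by rewrite scaler0; apply/rowP => i; rewrite !mxE comp_poly0 scaler0.
have jk : (j <= k)%N.
  move: F act; rewrite /free_coord /active; case: ifP => _ /andP[jk0 _]; first by case/andP.
  exact: leq_trans.
have /dvdXn_drop Em : 'X^(D k j) %| m 0 j by have := Hm j; rewrite jk.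
set n := drop_poly _ _ in Em *.
have expE : (D k0 j <= D k j + c)%N.
  move: F act; rewrite /free_coord /active; case: ifP => [_ _ /andP[jk' kk0]|left _ _].
    have : (D k0 j <= D k j)%N by apply: D_mono; rewrite jk'.
    by lia.
  by move: left; rewrite /left_coord; lia.
have w_v : (v^-1) ^- 2 = v ^+ 2 by rewrite exprVn invrK.
have compX (w : C) s : ('X^s : {poly C}) \Po (w *: 'X) = w ^+ s *: 'X^s.
  by rewrite rmorphXn /= comp_polyX exprZn.
apply/rowP => i; rewrite !mxE eqxx /=; case: eqVneq => [->|_]; last first.
  by rewrite !mulr0 comp_poly0 scaler0.
rewrite !mulr1 w_v Em !comp_polyM !compX.
set P := n \Po _; set E := (D k j + c - D k0 j)%N.
have -> : drop_poly (D k j) ((t j)^-1 ^+ 2 *: (P * (v ^+ 2 ^+ D k j *: 'X^(D k j)))) =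
    ((t j)^-1 ^+ 2 * v ^+ 2 ^+ D k j) *: P.
  by rewrite -scalerAr scalerA linearZ /= drop_polyMXn_id.
have PE : P \Po (v ^- 2 *: 'X) = n.
  by rewrite -comp_polyA comp_polyZ comp_polyX scalerA mulfV ?expf_neq0 // scale1r comp_polyXr.
rewrite comp_polyZ PE mul_polyC -scalerAl -scalerAr !scalerA.
congr (_ *: _); have -> : ((D k0 j)%:Z - c%:Z) * 2 = (2 * D k j)%N%:Z - (2 * E)%N%:Z.
  by rewrite /E; lia.
by rewrite expfzDr // -exprnN -!exprnP !exprM !exprVn; ring.
Qed.
End WeightBasis.

(** * Independence of the product of the choice of a weight basis *)

Section WeightProduct.
Variables (R : realType) (r : nat) (D : 'M[nat]_(r, r.+1)).
Local Notation C := R[i].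
Local Notation sect := 'rV[{poly C}]_r.+1.
Local Notation subsh := (subsheaf (R := R) D).
Local Notation character := ({ffun 'I_r.+1 -> int} * int)%type.

(** This avoids casts between the ordinals below [size s] and those below a propositionally equal
    n. *)
Lemma tangent_weights_nth n (x0 : character) (w : 'I_n -> character) (e : 'I_n -> cochain R r) s :
  size s = n -> (forall i : 'I_n, nth x0 s i = w i) ->
  (forall i, tangent_vector D (e i)) ->
  (forall phi, tangent_vector D phi -> exists! c : 'rV[C]_n,
     same_cochain D phi (fun k m => \sum_i (c 0 i)%:P *: e i k m)) ->
  (forall i t v, in_torus t v -> same_cochain D (torus_act t v (e i))
     (fun k m => (char_val (w i) t v)%:P *: e i k m)) ->
  tangent_weights R D s.
Proof.
move=> Es; case: n / Es w e => w e Ew H1 H2 H3; exists e; split=> // i t v tv.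
by rewrite (tnth_nth x0) Ew; exact: H3.
Qed.

Lemma torus_sect_subsheaf k (t : 'I_r.+1 -> C) v (m : sect) :
  subsh k m -> subsh k (torus_sect t v m).
Proof.
move=> /subsheafP Hm; apply/subsheafP => j; have := Hm j; rewrite mxE.
case: ifP => _ [E]; last by rewrite E comp_poly0 scaler0.
rewrite (dvdXn_drop E) comp_polyM rmorphXn /= comp_polyX exprZn -scalerAr scalerA.
by rewrite -mul_polyC mulrA dvdp_mulIr.
Qed.

Lemma torus_sectB (t : 'I_r.+1 -> C) v (m m' : sect) :
  torus_sect t v (m - m') = torus_sect t v m - torus_sect t v m'.
Proof. by apply/rowP => j; rewrite !mxE comp_polyB scalerBr. Qed.

Lemma torus_sect_sum n (t : 'I_r.+1 -> C) v (c : 'I_n -> C) (f : 'I_n -> sect) :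
  torus_sect t v (\sum_i (c i)%:P *: f i) = \sum_i (c i)%:P *: torus_sect t v (f i).
Proof.
apply/rowP => j; rewrite mxE !summxE raddf_sum scaler_sumr; apply: eq_bigr => i _ /=.
by rewrite !mxE comp_polyM comp_polyC !mul_polyC !scalerA mulrC.
Qed.

Lemma torus_act_same (t : 'I_r.+1 -> C) v (phi psi : cochain R r) :
  same_cochain D phi psi -> same_cochain D (torus_act t v phi) (torus_act t v psi).
Proof.
move=> H k m Hm; rewrite /torus_act -torus_sectB; apply: torus_sect_subsheaf.
by apply: H; exact: torus_sect_subsheaf.
Qed.

(* Both lists of weights give the characteristic polynomial, at 1, of the action of (t, v) on
   the tangent space modulo same_cochain. *)
Lemma tangent_weights_prod (s s' : seq character) (t : 'I_r.+1 -> C) v :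
  tangent_weights R D s -> tangent_weights R D s' -> in_torus t v ->
  \prod_(chi <- s) (1 - char_val chi t v) = \prod_(chi <- s') (1 - char_val chi t v).
Proof.
move=> [e [Te He We]] [e' [Te' He' We']] tv.
have choose_rep n n' (e1 : 'I_n -> cochain R r) (e2 : 'I_n' -> cochain R r) :
    (forall i, tangent_vector D (e2 i)) ->
    (forall phi, tangent_vector D phi -> exists! c : 'rV[C]_n,
       same_cochain D phi (fun k m => \sum_i (c 0 i)%:P *: e1 i k m)) ->
    exists P : 'M[C]_(n', n), forall i, same_cochain D (e2 i)
       (fun k m => \sum_j (P i j)%:P *: e1 j k m).
  move=> T2 H1; have /choice[f Hf] i : exists c : 'rV[C]_n,
      same_cochain D (e2 i) (fun k m => \sum_j (c 0 j)%:P *: e1 j k m).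
    by have [c [Hc _]] := H1 _ (T2 i); exists c.
  exists (\matrix_i f i) => i k m Hm.
  by under eq_bigr do rewrite mxE; exact: Hf.
have [P HP] := choose_rep _ _ e e' Te' He.
have [P' HP'] := choose_rep _ _ e' e Te He'.
have uniq n (e1 : 'I_n -> cochain R r) (c1 c2 : 'rV[C]_n) :
    (forall i, tangent_vector D (e1 i)) ->
    (forall phi, tangent_vector D phi -> exists! c : 'rV[C]_n,
       same_cochain D phi (fun k m => \sum_i (c 0 i)%:P *: e1 i k m)) ->
    same_cochain D (fun k m => \sum_i (c1 0 i)%:P *: e1 i k m)
      (fun k m => \sum_i (c2 0 i)%:P *: e1 i k m) -> c1 = c2.
  move=> T1 H1 E; have [c [_ Hc]] := H1 _ (tangent_sum (fun i => c1 0 i) T1).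
  rewrite -(Hc _ E); apply/esym/Hc => k m Hm; rewrite subrr; exact: subsheaf0.
have subst_rep n n' (e1 : 'I_n -> cochain R r) (e2 : 'I_n' -> cochain R r)
    (Q : 'M[C]_(n', n)) (c : 'rV[C]_n') :
    (forall i, same_cochain D (e2 i) (fun k m => \sum_j (Q i j)%:P *: e1 j k m)) ->
    same_cochain D (fun k m => \sum_i (c 0 i)%:P *: e2 i k m)
      (fun k m => \sum_j ((c *m Q) 0 j)%:P *: e1 j k m).
  move=> HQ k m Hm.
  have -> : \sum_j ((c *m Q) 0 j)%:P *: e1 j k m =
      \sum_i (c 0 i)%:P *: \sum_j (Q i j)%:P *: e1 j k m.
    under [RHS]eq_bigr do rewrite scaler_sumr.
    rewrite exchange_big /=; apply: eq_bigr => j _.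
    rewrite mxE rmorph_sum scaler_suml; apply: eq_bigr => i _.
    by rewrite scalerA -polyCM.
  rewrite -sumrB; apply: subsheaf_sum => i; rewrite -scalerBr.
  by apply: subsheafZ; exact: HQ.
have same_trans (a b c : cochain R r) : same_cochain D a b -> same_cochain D b c ->
    same_cochain D a c.
  move=> H1 H2 k m Hm; have := subsheafD (H1 k m Hm) (H2 k m Hm).
  by rewrite addrA subrK.
have same_sym (a b : cochain R r) : same_cochain D a b -> same_cochain D b a.
  by move=> H1 k m Hm; have := subsheafN (H1 k m Hm); rewrite opprB.
have delta_sum n (e1 : 'I_n -> cochain R r) (i : 'I_n) k m (b : C) :
    \sum_j ((b *: delta_mx 0 i : 'rV[C]_n) 0 j)%:P *: e1 j k m = b%:P *: e1 i k m.
  rewrite (bigD1 i) //= big1 => [|j neq_ji]; first by rewrite !mxE !eqxx mulr1 addr0.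
  by rewrite !mxE eqxx (negPf neq_ji) mulr0 polyC0 scale0r.
have inv_rep n n' (e1 : 'I_n -> cochain R r) (e2 : 'I_n' -> cochain R r)
    (Q : 'M[C]_(n', n)) (Q' : 'M[C]_(n, n')) :
    (forall i, tangent_vector D (e1 i)) ->
    (forall phi, tangent_vector D phi -> exists! c : 'rV[C]_n,
       same_cochain D phi (fun k m => \sum_i (c 0 i)%:P *: e1 i k m)) ->
    (forall i, same_cochain D (e2 i) (fun k m => \sum_j (Q i j)%:P *: e1 j k m)) ->
    (forall i, same_cochain D (e1 i) (fun k m => \sum_j (Q' i j)%:P *: e2 j k m)) ->
    Q' *m Q = 1%:M.
  move=> T1 H1 HQ HQ'; apply/row_matrixP => i; rewrite row_mul row1 rowE.
  have S := same_trans _ _ _ (subst_rep _ _ _ _ _ (delta_mx 0 i) HQ')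
    (subst_rep _ _ _ _ _ (delta_mx 0 i *m Q') HQ).
  by apply/esym; exact: (uniq _ e1).
have PP' := inv_rep _ _ _ _ _ _ Te He HP HP'.
have P'P := inv_rep _ _ _ _ _ _ Te' He' HP' HP.
pose g (s0 : seq character) i := char_val (tnth (in_tuple s0) i) t v.
(* Acting by (t, v) on the expansion of [e' i] in the basis [e] and comparing coefficients shows
   that the transition matrix intertwines the two diagonal actions. *)
have Pg i j : g s' i * P i j = P i j * g s j.
  have E : (g s' i *: row i P) = \row_j (P i j * g s j).
    apply: (uniq _ e) => //.
    apply: (same_trans _ (fun k m => (g s' i)%:P *: e' i k m)).
      move=> k m Hm; rewrite -(delta_sum _ e' i k m (g s' i)).
      have := same_sym _ _ (subst_rep _ _ _ _ _ (g s' i *: delta_mx 0 i) HP) k m Hm.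
      by rewrite -scalemxAl -rowE.
    apply: (same_trans _ (torus_act t v (e' i))); first exact/same_sym/We'.
    apply: (same_trans _ (torus_act t v (fun k m => \sum_j (P i j)%:P *: e j k m))).
      exact/torus_act_same/HP.
    move=> k m Hm; rewrite [torus_act _ _ _ _ _]torus_sect_sum.
    rewrite -sumrB; apply: subsheaf_sum => l.
    rewrite mxE polyCM -scalerA -scalerBr; apply: subsheafZ; exact: We.
  by have /rowP/(_ j) := E; rewrite !mxE.
have Esz : size s' = size s.
  apply/eqP; rewrite eqn_leq; apply/andP; split.
  - exact: mulmx1_min P'P.
  - exact: mulmx1_min PP'.
pose Dg (s0 : seq character) : 'M[C]_(size s0) := diag_mx (\row_i (1 - g s0 i)).
have PD : Dg s' *m P = P *m Dg s.
  apply/matrixP => i j; rewrite mul_diag_mx mul_mx_diag !mxE.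
  by rewrite mulrBl mulrBr mul1r mulr1 Pg.
have prodE s0 : \prod_(chi <- s0) (1 - char_val chi t v) = \det (Dg s0).
  rewrite det_diag big_tnth; apply: eq_bigr => i _; by rewrite mxE.
rewrite !prodE.
(* The two sizes are equal only propositionally, so conjugation invariance is stated for two sizes
   which are then identified. *)
have conj n n' (G : 'M[C]_n) (G' : 'M[C]_n') (Q : 'M[C]_(n', n)) (Q' : 'M[C]_(n, n')) :
    n' = n -> G' *m Q = Q *m G -> Q' *m Q = 1%:M -> \det G' = \det G.
  move=> En; subst n' => GQ QQ.
  have nz : \det Q != 0.
    have := congr1 determinant QQ; rewrite det_mulmx det1 => H.
    by apply: contra_eq_neq H => ->; rewrite mulr0 eq_sym oner_neq0.
  by apply: (mulIf nz); rewrite -det_mulmx GQ det_mulmx mulrC.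
by apply/esym; exact: conj PD PP'.
Qed.
End WeightProduct.

(** * The free coordinates index a basis of the tangent space *)

Section FixedPointWeights.
Variables (R : realType) (r : nat) (D : 'M[nat]_(r, r.+1)) (N : nat).
Local Notation C := R[i].
Local Notation subsh := (subsheaf (R := R) D).
Local Notation index := ('I_r * 'I_r.+1 * 'I_r.+1 * 'I_N)%type.

Hypothesis D_mono : forall (i k : 'I_r) (j : 'I_r.+1),
  (j <= k <= i)%N -> (D i j <= D k j)%N.
Hypothesis D_lt : forall (k : 'I_r) (j : 'I_r.+1), (D k j < N)%N.

Definition free_index : {set index} :=
  [set f : index | free_coord D f.1.1.1 f.1.1.2 f.1.2 f.2].

Definition index_basis (f : index) : cochain R r :=
  basis_vector D f.1.1.1 f.1.1.2 f.1.2 f.2.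

Definition index_coord (phi : cochain R r) (f : index) : C :=
  tcoord D phi f.1.1.1 f.1.1.2 f.1.2 f.2.

Definition index_left (f : index) : bool := left_coord D f.1.1.1 f.1.1.2 f.1.2 f.2.

(** Away from its own row, a basis vector has nonzero free coordinates only at smaller height,
    whichever way it propagates. This makes [coord_mx] unitriangular. *)
Definition height (f : index) : nat :=
  if index_left f then (f.1.1.1 : nat) else (r - f.1.1.1)%N.

Lemma index_coord_basis (f f' : index) : f \in free_index -> f' \in free_index ->
  index_coord (index_basis f') f != 0 -> f = f' \/ (height f < height f')%N.
Proof.
case: f => [[[k j] l] c]; case: f' => [[[k' j'] l'] c']; rewrite !inE /= => F F'.
rewrite /index_coord /index_basis /= coord_basis_vector.
case: (boolP [&& _, _, _ & _]) => [/and4P[act /eqP Ej /eqP El /eqP Ec] _|_]; last by rewrite eqxx.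
subst j' l'; rewrite /height /index_left /=.
have DD (i i' : 'I_r) : (j <= i)%N -> (i <= i')%N -> (D i' j <= D i j)%N.
  by move=> ji ii'; apply: D_mono; rewrite ji.
case: (ltngtP k k') => [kk'|kk'|Ek]; last 1 first.
- left; move/val_inj: Ek => Ek; subst k'.
  by congr (_, _, _, _); apply: val_inj => /=; lia.
- right; move: act F F'; rewrite /active /free_coord.
  case: ifP => [left' /andP[jk _]|_]; last by lia.
  have -> : left_coord D k j l c; last by [].
  by move: left'; rewrite /left_coord; have := DD k k' jk (ltnW kk'); lia.
- right; move: act F F'; rewrite /active /free_coord.
  case: ifP => [_ /andP[_]|left' _]; first by lia.
  move=> /andP[jk _] /andP[jk' _].
  have -> : left_coord D k j l c = false; last by have := ltn_ord k; lia.
  by move: left'; rewrite /left_coord; have := DD k' k jk' (ltnW kk'); lia.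
Qed.

Lemma index_coord_diag f : f \in free_index -> index_coord (index_basis f) f = 1.
Proof.
case: f => [[[k j] l] c]; rewrite inE /index_coord /index_basis /= coord_basis_vector !eqxx.
rewrite /active /free_coord => /andP[jk _]; rewrite jk leqnn if_same /=.
by rewrite addnC addnK eqxx.
Qed.

Let n := #|free_index|.
Let idx (i : 'I_n) : index := enum_val i.
Let idxP i : idx i \in free_index. Proof. exact: enum_valP. Qed.

Definition coord_mx : 'M[C]_n :=
  \matrix_(i, i') index_coord (index_basis (idx i)) (idx i').

(** A row vector killed by the matrix has entries 0, by induction starting from the largest height:
    column i involves only i itself and indices of larger height. *)
Lemma coord_mx_unit : coord_mx \in unitmx.
Proof.
rewrite -row_free_unit; apply: inj_row_free => v vM.
have hr i : (height (idx i) <= r)%N.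
  by rewrite /height; case: ifP => _; rewrite ?leq_subr // ltnW // ltn_ord.
suff H b i : (r - height (idx i) <= b)%N -> v 0 i = 0.
  by apply/rowP => i; rewrite mxE (H _ i (leqnn _)).
elim: b i => [|b IHb] i ib.
all: have /rowP/(_ i) := vM; rewrite !mxE (bigD1 i) //= mxE index_coord_diag ?idxP // mulr1.
all: rewrite big1 ?addr0 // => i' neq_i'i; rewrite mxE.
all: case: (eqVneq (index_coord (index_basis (idx i')) (idx i)) 0) => [->|nz];
  first by rewrite mulr0.
all: case: (index_coord_basis (idxP i) (idxP i') nz) => [/enum_val_inj E|lt_h];
  first by rewrite E eqxx in neq_i'i.
- by have := hr i'; have := hr i; lia.
- by rewrite IHb ?mul0r //; have := hr i'; have := hr i; lia.
Qed.

Lemma coord_same phi psi : same_cochain D phi psi ->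
  forall f, f \in free_index -> index_coord phi f = index_coord psi f.
Proof.
move=> S [[[k j] l] c]; rewrite inE /= => F.
have jk : (j <= k)%N by case/andP: F.
have := S k _ (gen_subsheaf R D jk); move=> /subsheafP/(_ l).
rewrite !mxE /index_coord /tcoord /= => E; apply/eqP; rewrite -subr_eq0 -coefB; apply/eqP.
case: ifP E => [lk /dvdXnP|_ ->]; last by rewrite coef0.
apply; move: F; rewrite /free_coord lk /=; case: ifP => _; first by case/and4P.
by case/and3P.
Qed.

Lemma index_coord_sum (c : 'I_n -> C) (e : 'I_n -> cochain R r) f :
  index_coord (fun k m => \sum_i (c i)%:P *: e i k m) f = \sum_i c i * index_coord (e i) f.
Proof.
rewrite /index_coord /tcoord summxE coef_sum; apply: eq_bigr => i _.
by rewrite mxE coefCM.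
Qed.

Definition weight_list : seq ({ffun 'I_r.+1 -> int} * int)%type :=
  [seq weight D f.1.1.1 f.1.1.2 f.1.2 f.2 | f : index <- enum free_index].

(** Inverting [coord_mx] gives a combination of basis vectors with the same free coordinates as phi;
    the difference is 0 in the tangent space by [coord_free_eq0]. The coefficients are unique
    because free coordinates depend only on the class of a cochain. *)
Lemma weight_listP : tangent_weights R D weight_list.
Proof.
have size_w : size weight_list = n by rewrite size_map -cardE.
have T i : tangent_vector D (index_basis (idx i)).
  by apply: basis_tangent => //; have := idxP i; rewrite inE.
apply: (@tangent_weights_nth _ _ _ n ([ffun => 0], 0)
   (fun i => weight D (idx i).1.1.1 (idx i).1.1.2 (idx i).1.2 (idx i).2)
   (fun i => index_basis (idx i))) => //.
- move=> i; rewrite (nth_map (idx i)) -?cardE //.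
  by rewrite -(enum_val_nth (idx i)).
- move=> phi Tphi; pose u : 'rV_n := \row_i index_coord phi (idx i).
  exists (u *m invmx coord_mx); split.
    set c := _ *m _.
    apply: (coord_free_eq0 D_mono
      (phi := fun k m => phi k m - \sum_i (c 0 i)%:P *: index_basis (idx i) k m)).
      by apply: tangentB => //; exact: tangent_sum.
    move=> k j l a F.
    have aN : (a < N)%N.
      move: (F); rewrite /free_coord; case: ifP => [left|_] /andP[jk]; last first.
        by case/and3P => _ /leq_trans-> //; exact: ltnW.
      case: (leqP l k) => [lk|kl].
        by case/and3P => /implyP/(_ isT)/leq_trans-> //; exact: ltnW.
      move: left; rewrite /left_coord leqNgt (leq_ltn_trans jk kl) /= => /leq_trans-> //.
      exact: ltnW.
    pose f : index := (k, j, l, Ordinal aN).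
    have fF : f \in free_index by rewrite inE.
    rewrite -[tcoord _ _ _ _ _ _]/(index_coord _ f).
    have -> : f = idx (enum_rank_in fF f) by rewrite /idx enum_rankK_in.
    set i := enum_rank_in _ _.
    rewrite /index_coord /tcoord !mxE coefB; apply/eqP; rewrite subr_eq0; apply/eqP.
    have E : u 0 i = (c *m coord_mx) 0 i by rewrite mulmxKV ?coord_mx_unit.
    move: E; rewrite mxE [RHS]mxE => E; rewrite -[LHS]/(index_coord phi (idx i)) E.
    rewrite -[RHS]/(index_coord (fun k m => \sum_i (c 0 i)%:P *: index_basis (idx i) k m) (idx i)).
    by rewrite index_coord_sum; apply: eq_bigr => i' _; rewrite [coord_mx _ _]mxE.
  move=> c' /coord_same Hc'.
  have -> : u = c' *m coord_mx; last by rewrite mulmxK ?coord_mx_unit.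
  apply/rowP => i; rewrite !mxE Hc' ?idxP // index_coord_sum.
  by apply: eq_bigr => i' _; rewrite mxE.
- by move=> i t v tv; apply: basis_weight => //; have := idxP i; rewrite inE.
Qed.

(** The list picked by [xget] is unknown but is a list of weights, as one exists;
    [tangent_weights_prod] replaces it by [weight_list]. *)
Lemma S_chiE (t : 'I_r.+1 -> C) v : in_torus t v ->
  S_chi D t v = \prod_(f : index | f \in free_index)
    (1 - t f.1.2 ^+ 2 / t f.1.1.2 ^+ 2 * v ^ (((D f.1.1.1 f.1.1.2)%:Z - (f.2)%:Z) * 2))^-1.
Proof.
move=> tv; rewrite /S_chi prodfV.
have W : tangent_weights R D (xget [::] [set s | tangent_weights R D s]).
  exact: (xgetPex [::] (ex_intro _ _ weight_listP)).
rewrite (tangent_weights_prod W weight_listP tv) big_map -big_enum /= prodfV; congr (_^-1).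
by apply: eq_bigr => f _; rewrite char_val_weight.
Qed.
End FixedPointWeights.

(** * The localization sum *)

Section Localization.
Variables (R : realType) (r : nat) (t : 'I_r.+1 -> R[i]) (v : R[i]).
Hypothesis tv : in_torus t v.
Hypothesis tv_gen : generic t v.
Local Notation C := R[i].

Definition yparam (j : nat) : C := t (inord j) ^+ 2.
Local Notation q := (v ^+ 2).

Lemma q_neq0 : q != 0. Proof. by case: tv => _ v0; exact: expf_neq0. Qed.

Lemma t_neq0 j : t j != 0.
Proof. by case: tv => /prod_eq1_neq0. Qed.

Lemma y_neq0 j : (j <= r)%N -> yparam j != 0.
Proof. by move=> _; apply: expf_neq0; exact: t_neq0. Qed.

Lemma y_gen i j (m : int) : (i <= r)%N -> (j <= r)%N ->
  yparam i = yparam j * q ^ m -> i = j /\ m = 0.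
Proof.
move=> ir jr; rewrite [q]exprnP exprz_exp => /tv_gen[E ->]; split=> //.
by have := congr1 val E; rewrite /= !inordK.
Qed.

Lemma S_chi_rows (D : 'M[nat]_(r, r.+1)) :
  (forall (i k : 'I_r) (j : 'I_r.+1), (j <= k <= i)%N -> (D i j <= D k j)%N) ->
  S_chi D t v = \prod_(k < r)
    (Knum q yparam k (fun j => Dext D k (inord j)) *
     Kden q yparam k (fun j => Dext D k (inord j)) (fun j => Dext D k.+1 (inord j))).
Proof.
move=> D_mono; pose N := (\sum_k \sum_j D k j).+1.
have D_lt k j : (D k j < N)%N.
  by rewrite ltnS (bigD1 k) //= (bigD1 j) //= -!addnA leq_addr.
rewrite (S_chiE D_mono D_lt tv) big_mkcond /=.
have Dext_lt k j : (Dext D k j <= N)%N.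
  by rewrite /Dext; case: insubP => // k' _ _; exact: ltnW.
have Dext_anti k (j : 'I_r.+1) : (j <= k)%N -> (Dext D k.+1 j <= Dext D k j)%N.
  move=> jk; rewrite {1}/Dext; case: insubP => // k' _ Ek'.
  have kr : (k < r)%N by apply: ltnW; rewrite -Ek'; exact: ltn_ord.
  rewrite -[k]/(nat_of_ord (Ordinal kr)) DextE; apply: D_mono.
  by rewrite jk Ek' leqnSn.
have Dext_r j : Dext D r j = 0%N by rewrite /Dext insubN // ltnn.
pose G k (j l : 'I_r.+1) (c : nat) :=
  (1 - q ^ ((Dext D k j)%:Z - c%:Z) * (t l ^+ 2 / t j ^+ 2))^-1.
pose fs (j l : 'I_r.+1) := free_step j l (Dext D ^~ j) (Dext D ^~ l).
(* The telescoping of [free_prod] needs the pair (j, l) outermost; afterwards the products are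
   exchanged again to collect the factors of each row k. *)
transitivity (\prod_(j < r.+1) \prod_(l < r.+1) \prod_(k < r) \prod_(c < N | fs j l k c) G k j l c).
  under [RHS]eq_bigr do rewrite exchange_big.
  rewrite [RHS]exchange_big /= pair_bigA pair_bigA.
  under [RHS]eq_bigr do rewrite big_mkcond.
  rewrite pair_bigA; apply: eq_bigr => f _ /=.
  rewrite inE /free_coord /fs /free_step /left_coord !DextE; case: ifP => // _.
  by rewrite /G DextE [q]exprnP exprz_exp [2 * _]mulrC [_ * v ^ _]mulrC.
have q0 := q_neq0.
have tt (j : 'I_r.+1) : t j ^+ 2 = yparam j by rewrite /yparam inord_val.
have le_r (j : 'I_r.+1) : (j <= r)%N by rewrite -ltnS.
have FP (j l : 'I_r.+1) := @free_prod C q (t l ^+ 2 / t j ^+ 2) q0 r N j l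
  (Dext D ^~ j) (Dext D ^~ l) (le_r l).
pose H1 (k : nat) (j l : 'I_r.+1) : C := if (l <= k.+1)%N
  then qpochV q (t l ^+ 2 / t j ^+ 2) ((Dext D k j)%:Z - (Dext D k.+1 l)%:Z) else 1.
pose H2 (k : nat) (j l : 'I_r.+1) : C := if (l <= k)%N && (l != j)
  then (qpochV q (t l ^+ 2 / t j ^+ 2) ((Dext D k j)%:Z - (Dext D k l)%:Z))^-1 else 1.
transitivity (\prod_(j < r.+1) \prod_(l < r.+1) \prod_(k < r | (j <= k)%N) (H1 k j l * H2 k j l)).
  apply: eq_bigr => j _; apply: eq_bigr => l _; apply: FP.
  - by move=> k jk kr; exact: Dext_anti.
  - by move=> k /andP[lk kr]; exact: Dext_anti.
  - exact: Dext_r.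
  - by move=> k; exact: Dext_lt.
  - by move=> k; exact: Dext_lt.
  - move=> e e0; rewrite !tt; apply: (qpochV_factor_neq0 y_neq0 y_gen) => // E.
    by rewrite gt_eqF // e0.
  - by move=> /val_inj ->.
transitivity (\prod_(k < r) \prod_(j < r.+1 | (j <= k)%N) \prod_(l < r.+1) (H1 k j l * H2 k j l)).
  rewrite [RHS](exchange_big_dep xpredT) //=; apply: eq_bigr => j _.
  by rewrite exchange_big.
apply: eq_bigr => k _; have lt_kr := ltn_ord k.
rewrite [Knum _ _ _ _ * _]mulrC.
under eq_bigr do rewrite big_split.
rewrite big_split /=; congr (_ * _).
  rewrite /Kden (big_ord_widen r.+1 (fun j : nat => \prod_(l < k.+2)
    qpochV q (yparam l / yparam j) ((Dext D k (inord j))%:Z - (Dext D k.+1 (inord l))%:Z))) //;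
    last by lia.
  apply: eq_bigr => j _.
  rewrite (big_ord_widen r.+1 (fun l : nat =>
    qpochV q (yparam l / yparam j) ((Dext D k (inord j))%:Z - (Dext D k.+1 (inord l))%:Z))) //.
  rewrite [RHS]big_mkcond; apply: eq_bigr => l _.
  by rewrite /H1 !tt !inord_val.
rewrite /Knum (big_ord_widen r.+1 (fun j : nat => \prod_(l < k.+1 | l != j :> nat)
    (qpochV q (yparam l / yparam j) ((Dext D k (inord j))%:Z - (Dext D k (inord l))%:Z))^-1)) //;
  last by lia.
apply: eq_bigr => j _.
rewrite (big_ord_widen_cond r.+1 (fun l : nat => l != j) (fun l : nat =>
    (qpochV q (yparam l / yparam j) ((Dext D k (inord j))%:Z - (Dext D k (inord l))%:Z))^-1)) //;
  last by lia.
rewrite [RHS]big_mkcond; apply: eq_bigr => l _.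
by rewrite /H2 !tt !inord_val andbC.
Qed.
End Localization.

(** * Unfolding F_m into a sum over families of rows *)

Section FsumChain.
Variables (F : fieldType) (q : F) (y : nat -> F) (r : nat).
Local Notation row B := {ffun 'I_r.+1 -> 'I_B.+1}.

(** Integer degrees allow d - e_k to be formed without truncation; when d_k = 0 the sum over rows is
    empty, in agreement with [mulQ]. *)
Lemma Fsum_neg B m (d : nat -> int) p k : (k < m)%N -> d k < 0 -> Fsum q y r B m d p = 0.
Proof.
elim: m p => [|m IHm] p //; rewrite ltnS leq_eqVlt => /orP[/eqP-> dm|km dk] /=.
  by rewrite big_pred0 // => a; apply/negP => /andP[_ /eqP E]; rewrite -E in dm.
by rewrite big1 // => a _; rewrite IHm // mulr0.
Qed.

Definition conv_row B B' (a : row B) : row B' := [ffun j => inord (a j)].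

Lemma rowf_conv B B' (a : row B) j :
  (rowf a j <= B')%N -> rowf (conv_row B' a) j = rowf a j.
Proof.
case: (leqP j r) => [jr|lt_rj]; last by rewrite !rowf_out.
pose j' := Ordinal (jr : (j < r.+1)%N).
have E B0 (b : row B0) : rowf b j = b j' := rowfE b j'.
by rewrite !E ffunE => ajB; rewrite inordK.
Qed.

Lemma rowf_le_sum B m (a : row B) j : supported m a ->
  (rowf a j <= \sum_(j < m) rowf a j)%N.
Proof.
move=> /supportedP sa; case: (ltnP j m) => [jm|/sa -> //].
by rewrite (bigD1 (Ordinal jm)) //= leq_addr.
Qed.

Lemma eq_sum_rows B B' m (N : nat) (G : (nat -> nat) -> F) : (N <= B)%N -> (N <= B')%N ->
  \sum_(a : row B | supported m a && ((\sum_(j < m) rowf a j)%N == N)) G (rowf a) =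
  \sum_(a : row B' | supported m a && ((\sum_(j < m) rowf a j)%N == N)) G (rowf a).
Proof.
move=> NB NB'.
have conv B1 B2 (a : row B1) : (N <= B2)%N -> supported m a ->
    (\sum_(j < m) rowf a j)%N = N -> rowf (conv_row B2 a) =1 rowf a.
  move=> NB2 sa aN j; apply: rowf_conv; apply: leq_trans NB2.
  by rewrite -aN rowf_le_sum.
rewrite [RHS](reindex_onto (@conv_row B B') (@conv_row B' B)); last first.
  move=> a /andP[sa /eqP aN]; apply: rowf_inj => j.
  rewrite rowf_conv; first by rewrite conv.
  by rewrite conv // (leq_trans _ NB') // -aN rowf_le_sum.
apply: eq_big => [a|a /andP[sa /eqP aN]]; last first.
  by congr G; apply/funext => j; rewrite conv.
have key (b : row B) (b' : row B') : rowf b =1 rowf b' ->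
    supported m b && ((\sum_(j < m) rowf b j)%N == N) =
    supported m b' && ((\sum_(j < m) rowf b' j)%N == N).
  move=> E; congr andb; last by congr (_ == _); apply: eq_bigr => j _; rewrite E.
  by apply/supportedP/supportedP => H j mj; have := H j mj; rewrite E.
apply/idP/idP => [Pa|/andP[Pa /eqP Ea]].
  have /andP[sa /eqP aN] := Pa; have E := conv _ B' a NB' sa aN.
  rewrite -(key a) ?Pa //=; apply/eqP/rowf_inj => j.
  by rewrite rowf_conv E // (leq_trans _ NB) // -aN rowf_le_sum.
have /andP[sa /eqP aN] := Pa.
by rewrite (key _ (conv_row B' a)) // => j; rewrite -[in LHS]Ea (conv _ B).
Qed.

(** [RGamma(Q_d, O)] comes with the bound \sum_k d_k, which differs for d and d - e_i, whereas the
    Toda equation for F_m needs a common one. *)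
Lemma Fsum_bound B B' m (d : nat -> int) p :
  (forall k, (k < m)%N -> d k <= B%:Z) -> (forall k, (k < m)%N -> d k <= B'%:Z) ->
  Fsum q y r B m d p = Fsum q y r B' m d p.
Proof.
elim: m p => [|m IHm] p dB dB' //=.
have dBm := dB m (ltnSn m); have dBm' := dB' m (ltnSn m).
under eq_bigr => a _ do rewrite (IHm _ (fun k km => dB k (leqW km)) (fun k km => dB' k (leqW km))).
case: (d m) dBm dBm' => N NB NB'.
  exact: (eq_sum_rows m.+1 (fun a => Knum q y m a * Kden q y m a p * Fsum q y r B' m d a) NB NB').
by rewrite !big_pred0 // => a; rewrite andbF.
Qed.

Section Chain.
Variable B : nat.

(** Row m is the boundary row p, so that the last factor refers to row k + 1 like the others. *)
Definition rows_of m (f : {ffun 'I_m -> row B}) (p : nat -> nat) (k : nat) : nat -> nat :=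
  if insub k is Some k' then rowf (f (k' : 'I_m)) else p.

Definition good_row (d : nat -> int) (k : nat) (a : row B) : bool :=
  supported k.+1 a && ((\sum_(j < k.+1) rowf a j)%N%:Z == d k).

Lemma Fsum_chain m d p : Fsum q y r B m d p =
  \sum_(f : {ffun 'I_m -> row B} | [forall k : 'I_m, good_row d k (f k)])
    \prod_(k < m) (Knum q y k (rows_of f p k) * Kden q y k (rows_of f p k) (rows_of f p k.+1)).
Proof.
elim: m p => [|m IHm] p.
  rewrite (big_pred1 [ffun k => [ffun => ord0]]) ?big_ord0 // => f.
  transitivity true; first by apply/forallP; case.
  by apply/esym/eqP/ffunP; case.
(* The row of the outermost sum becomes the last value of the family, and the boundary row for the
   values before it. *)
pose join (x : {ffun 'I_m -> row B} * row B) : {ffun 'I_m.+1 -> row B} :=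
  [ffun k => if unlift ord_max k is Some k' then x.1 k' else x.2].
have joinL x k : join x (lift ord_max k) = x.1 k by rewrite ffunE liftK.
have joinM x : join x ord_max = x.2 by rewrite ffunE unlift_none.
pose split (f : {ffun 'I_m.+1 -> row B}) :=
  ([ffun k => f (lift ord_max k)] : {ffun _ -> _}, f ord_max).
have joinK : cancel join split.
  case=> g a; congr (_, _); last exact: joinM.
  by apply/ffunP => k; rewrite ffunE joinL.
have splitK : cancel split join.
  move=> f; apply/ffunP => k; case: (unliftP ord_max k) => [k' ->|->].
    by rewrite joinL ffunE.
  by rewrite joinM.
rewrite (reindex join) /=; last by exists split => x _; [exact: joinK | exact: splitK].
rewrite [RHS](eq_bigl (fun x : {ffun 'I_m -> row B} * row B =>
  [forall k : 'I_m, good_row d k (x.1 k)] && good_row d m x.2)); last first.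
  move=> x; apply/forallP/andP => [H|[/forallP H1 H2] k].
    split; last by have := H ord_max; rewrite joinM.
    by apply/forallP => k; have := H (lift ord_max k); rewrite joinL lift_max.
  by case: (unliftP ord_max k) => [k' ->|->]; rewrite ?joinL ?joinM ?lift_max.
transitivity (\sum_(g : {ffun 'I_m -> row B} | [forall k : 'I_m, good_row d k (g k)])
  \sum_(a : row B | good_row d m a) \prod_(k < m.+1)
   (Knum q y k (rows_of (join (g, a)) p k) *
    Kden q y k (rows_of (join (g, a)) p k) (rows_of (join (g, a)) p k.+1))); last first.
  by rewrite pair_big /=; apply: eq_bigr => -[].
rewrite exchange_big /=; apply: eq_bigr => a _; rewrite IHm mulr_sumr.
apply: eq_bigr => g _; rewrite big_ord_recr /= mulrC.
have rowsE k : (k <= m)%N -> rows_of (join (g, a)) p k = rows_of g (rowf a) k.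
  rewrite leq_eqVlt => /orP[/eqP->|km].
    rewrite [RHS]/rows_of insubN ?ltnn // /rows_of.
    have -> : insub m = Some (@ord_max m) by exact: (valK (@ord_max m)).
    by rewrite joinM.
  pose k' := Ordinal km; rewrite /rows_of.
  have -> : insub k = Some k' by exact: (valK k').
  have := valK (lift ord_max k') : insub (nat_of_ord (lift ord_max k')) = _.
  by rewrite lift_max /= => ->; rewrite joinL.
congr (_ * _).
  by apply: eq_bigr => k _; rewrite !rowsE //; exact: ltnW.
have rows_m n (f : {ffun 'I_n -> row B}) p' : rows_of f p' n = p'.
  by rewrite /rows_of insubN ?ltnn.
by rewrite rowsE // !rows_m.
Qed.
End Chain.
End FsumChain.

Lemma sum_rowf r B m (a : {ffun 'I_r.+1 -> 'I_B.+1}) : (m <= r.+1)%N -> supported m a ->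
  (\sum_(j < m) rowf a j = \sum_j a j)%N.
Proof.
move=> mr /supportedP sa; rewrite (big_ord_widen r.+1 (rowf a) mr) big_mkcond /=.
apply: eq_bigr => j _; rewrite -rowfE; case: ltnP => // mj.
by rewrite sa.
Qed.

(** The value 0 at r is the degree of W (x) O, and the sum of the zero row, as [Fsum_toda]
    requires. *)
Definition degree_ext r (d : {ffun 'I_r -> nat}) (k : nat) : int :=
  if insub k is Some k' then (d k')%:Z else 0.

(** * The localization sum is F_r at the zero row *)

Section RGammaFsum.
Variables (R : realType) (r : nat) (t : 'I_r.+1 -> R[i]) (v : R[i]).
Hypothesis tv : in_torus t v.
Hypothesis tv_gen : generic t v.

(** The sum on the right runs over more matrices, without inequalities between rows; the extra terms
    vanish by [Kden_eq0]. Inequalities between consecutive rows imply all those in [fixed_point]. *)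
Lemma RGamma_Fsum (d : {ffun 'I_r -> nat}) :
  RGamma d t v = Fsum (v ^+ 2) (yparam t) r (\sum_k d k) r (degree_ext d) (fun=> 0%N).
Proof.
rewrite Fsum_chain /RGamma; set B := (\sum_k d k)%N.
pose mx (f : {ffun 'I_r -> {ffun 'I_r.+1 -> 'I_B.+1}}) : 'M['I_B.+1]_(r, r.+1) :=
  \matrix_(k, j) f k j.
rewrite (reindex mx) /=; last first.
  exists (fun D => [ffun k => [ffun j => D k j]]) => [f _|D _].
    by apply/ffunP => k; apply/ffunP => j; rewrite !ffunE mxE.
  by apply/matrixP => k j; rewrite mxE !ffunE.
pose step_mono (f : {ffun 'I_r -> {ffun 'I_r.+1 -> 'I_B.+1}}) :=
  [forall k : 'I_r, forall k' : 'I_r, forall j : 'I_r.+1,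
    ((k' == k.+1 :> nat) && (j <= k)%N) ==> (f k' j <= f k j)%N].
rewrite [RHS](bigID step_mono) /= [X in _ = _ + X]big1 ?addr0; last first.
  move=> f /andP[_ /forallPn[k /forallPn[k' /forallPn[j]]]].
  rewrite negb_imply -ltnNge => /andP[/andP[/eqP Ek jk] lt_f].
  rewrite (bigD1 k) //= (@Kden_eq0 _ _ _ _ _ _ j) ?mulr0 ?mul0r //.
    by apply: (y_neq0 tv); rewrite -ltnS.
  by rewrite -Ek /rows_of !valK !rowfE.
have mxE' f k j : map_mx (@nat_of_ord _) (mx f) k j = f k j by rewrite !mxE.
have monoP f : reflect (forall (i k : 'I_r) (j : 'I_r.+1), (j <= k <= i)%N ->
    (map_mx (@nat_of_ord _) (mx f) i j <= map_mx (@nat_of_ord _) (mx f) k j)%N) (step_mono f).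
  apply: (iffP idP) => [/forallP H i k j /andP[jk ki]|H]; last first.
    apply/forallP => k; apply/forallP => k'; apply/forallP => j; apply/implyP => /andP[/eqP Ek jk].
    by have := H k' k j; rewrite !mxE' Ek jk leqnSn; apply.
  rewrite !mxE'; case: i ki => i lt_ir /=.
  elim: i lt_ir => [|i IHi] lt_ir ki.
    by rewrite (_ : Ordinal lt_ir = k) //; apply: val_inj => /=; lia.
  move: ki; rewrite leq_eqVlt => /orP[/eqP Ek|ki].
    by rewrite (_ : Ordinal lt_ir = k) //; apply: val_inj.
  apply: leq_trans (IHi (ltnW lt_ir) ki).
  have /forallP/(_ (Ordinal lt_ir))/forallP/(_ j)/implyP := H (Ordinal (ltnW lt_ir)).
  by apply; rewrite /= eqxx (leq_trans jk).
apply: eq_big => [f|f fp]; last first.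
  rewrite (S_chi_rows tv tv_gen); last first.
    by case/and3P: fp => _ _ /forallP H i k j; move: (H i) => /forallP/(_ k)/forallP/(_ j)/implyP.
  have E k j : (j <= r)%N ->
      Dext (map_mx (@nat_of_ord _) (mx f)) k (inord j) = rows_of f (fun=> 0%N) k j.
    move=> jr; rewrite /Dext /rows_of; case: insubP => // k' _ _.
    by rewrite mxE' -rowfE inordK.
  apply: eq_bigr => k _; have lt_kr := ltn_ord k.
  congr (_ * _); first by apply: eq_Knum => j jk; apply: E; lia.
  by apply: eq_Kden => j jk; apply: E; lia.
apply/and3P/andP => [[/forallP H1 /forallP H2 /forallP H3]|[/forallP H1 /monoP H2]].
  split; last first.
    by apply/monoP => i k j; move: (H3 i) => /forallP/(_ k)/forallP/(_ j)/implyP.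
  apply/forallP => k; have sk : supported k.+1 (f k).
    apply/forallP => j; apply/implyP => kj; rewrite -mxE'.
    by move: (H1 k) => /forallP/(_ j)/implyP; apply.
  rewrite /good_row sk /= /degree_ext valK eqz_nat -(eqP (H2 k)).
  rewrite sum_rowf //; last by have := ltn_ord k; lia.
  by apply/eqP/eq_bigr => j _; rewrite mxE'.
have S (k : 'I_r) : supported k.+1 (f k) by case/andP: (H1 k).
split.
- apply/forallP => k; apply/forallP => j; apply/implyP => kj; rewrite mxE'.
  by have /forallP/(_ j)/implyP := S k; apply.
- apply/forallP => k; have /andP[_] := H1 k.
  rewrite sum_rowf //; last by have := ltn_ord k; lia.
  rewrite /degree_ext valK eqz_nat => /eqP <-.
  by apply/eqP/eq_bigr => j _; rewrite mxE'.
- apply/forallP => i; apply/forallP => k; apply/forallP => j; apply/implyP.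
  exact: H2.
Qed.
End RGammaFsum.

(** * Action of the shift operators *)

Section ComplexExp.
Variable R : realType.
Implicit Types x : R[i].

Lemma cexpD x x' : cexp (x + x') = cexp x * cexp x'.
Proof.
case: x x' => a b [a' b']; rewrite /cexp /= expRD cosD sinD.
by simpc; congr (_ +i* _)%C; ring.
Qed.

Lemma cexp0 : cexp 0 = 1 :> R[i].
Proof. by rewrite /cexp /= expR0 cos0 sin0 mulr1 mulr0. Qed.

Lemma cexp_neq0 x : cexp x != 0.
Proof.
have E : cexp x * cexp (- x) = 1 by rewrite -cexpD subrr cexp0.
by apply: contra_eq_neq E => ->; rewrite mul0r eq_sym oner_neq0.
Qed.

Lemma cexpN x : cexp (- x) = (cexp x)^-1.
Proof.
by apply: (mulIf (cexp_neq0 x)); rewrite -cexpD addNr cexp0 mulVf ?cexp_neq0.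
Qed.

Lemma cexpMn x n : cexp (x *+ n) = cexp x ^+ n.
Proof. by elim: n => [|n IHn]; rewrite ?cexp0 // mulrS cexpD IHn exprS. Qed.
End ComplexExp.

Section TodaShift.
Variables (R : realType) (r : nat).
Local Notation C := R[i].
Local Notation pt := ('I_r.+1 -> C).

Definition shift2 (hbar : C) (k : 'I_r.+1) (z : pt) : pt :=
  fun j => z j + (if j == k then hbar *+ 2 else 0).

Lemma Tshift2E hbar k (f : Qseries R r) d z :
  Tshift hbar k (Tshift hbar k f) d z = f d (shift2 hbar k z).
Proof.
rewrite /Tshift /shift2; congr (f d _); apply/funext => j.
by case: eqP => _; rewrite ?addr0 // mulr2n addrA.
Qed.

Lemma Qpow_shift2 hbar (k : 'I_r.+1) z (i : 'I_r) s :
  Qpow i s (shift2 hbar k z) = Qpow i s z *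
   ((if k == i :> nat then cexp (s * hbar) ^+ 2 else 1) *
    (if k == i.+1 :> nat then cexp (s * hbar) ^- 2 else 1)).
Proof.
have E0 : (lift ord_max i == k) = (k == i :> nat).
  by rewrite -[LHS]/(nat_of_ord (lift ord_max i) == k) lift_max eq_sym.
have E1 : (lift ord0 i == k) = (k == i.+1 :> nat).
  by rewrite -[LHS]/(nat_of_ord (lift ord0 i) == k) lift0 eq_sym.
rewrite /Qpow /shift2 E0 E1.
set a := z _; set b := z _; rewrite -!cexpMn -mulrnAr -cexpN -[1](@cexp0 R).
rewrite -!(fun_if (@cexp R)) -!cexpD; congr cexp.
by case: ifP => _; case: ifP => _; ring.
Qed.

(** The variable z_k occurs in Q_k and, with the opposite sign, in Q_(k-1), whence the difference of
    degrees; the missing degrees at both ends count as 0. *)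
Lemma monomial_shift2 hbar (k : 'I_r.+1) (z : pt) (d : {ffun 'I_r -> nat}) (q := cexp hbar ^+ 2) :
  \prod_i Qvar i (shift2 hbar k z) ^+ d i =
  q ^ (degree_ext d k - (if (0 < k)%N then degree_ext d k.-1 else 0)) *
  \prod_i Qvar i z ^+ d i.
Proof.
have q0 : q != 0 by rewrite expf_neq0 // cexp_neq0.
under eq_bigr => i _ do rewrite /Qvar Qpow_shift2 mul1r exprMn.
rewrite big_split /= mulrC; congr (_ * _).
under eq_bigr => i _ do rewrite exprMn -/q.
rewrite big_split /= expfzDr //; congr (_ * _).
  case: (ltnP k r) => [lt_kr|rk].
    rewrite (bigD1 (Ordinal lt_kr)) //= eqxx big1 ?mulr1 => [|i].
      by rewrite -[k : nat]/(nat_of_ord (Ordinal lt_kr)) /degree_ext valK.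
    by rewrite -val_eqE /= eq_sym => /negPf ->; rewrite expr1n.
  rewrite /degree_ext insubN -?leqNgt // expr0z big1 // => i _.
  by rewrite ifF ?expr1n //; have := ltn_ord i; lia.
case: (posnP k) => [k0|k_gt0].
  by rewrite oppr0 expr0z big1 // => i _; rewrite k0 expr1n.
have lt_kr : (k.-1 < r)%N by have := ltn_ord k; lia.
rewrite (bigD1 (Ordinal lt_kr)) //= prednK // eqxx big1 ?mulr1 => [|i]; last first.
  by rewrite -val_eqE /= => ni; rewrite ifF ?expr1n //; lia.
by rewrite -[k.-1]/(nat_of_ord (Ordinal lt_kr)) /degree_ext valK -exprnN exprVn.
Qed.
Variables (t : pt) (hbar : C) (logt : 'I_r -> C).
Hypothesis t1 : \prod_j t j = 1.
Hypothesis hbar_neq0 : hbar != 0.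
Hypothesis logtE : forall i : 'I_r, cexp (logt i) = \prod_(j < r.+1 | (j <= i)%N) t j.

Definition prefactor (z : pt) : C := \prod_i Qpow i (- logt i / hbar) z.

Let tau (n : nat) : C := \prod_(j < r.+1 | (j <= n)%N) t j.

Let t_nz j : t j != 0. Proof. exact: prod_eq1_neq0. Qed.

Let tau_nz n : tau n != 0.
Proof. by apply/prodf_neq0 => j _; exact: t_nz. Qed.

Let tau_recr n (k : 'I_r.+1) : k = n.+1 :> nat -> tau k = tau n * t k.
Proof.
move=> Ek; rewrite /tau (bigD1 k) //= mulrC; congr (_ * _).
by apply: eq_bigl => j; rewrite -val_eqE /= Ek; lia.
Qed.

(** The denominator [hbar] of the exponents cancels against the shift, leaving tau_(k-1)^2 / tau_k^2
    = t_k^-2. For k = r there is no variable Q_r, but tau_r = 1 because the product of the t_j is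
    1. *)
Lemma prefactor_shift2 k z :
  prefactor (shift2 hbar k z) = t k ^- 2 * prefactor z.
Proof.
rewrite /prefactor; under eq_bigr do rewrite Qpow_shift2 mulfVK //.
rewrite big_split /= mulrC; congr (_ * _).
under eq_bigr do rewrite cexpN logtE -/(tau _) -exprVn invrK.
rewrite big_split /=.
have -> : \prod_(i < r) (if k == i :> nat then (tau i)^-1 ^+ 2 else 1) = tau k ^- 2.
  case: (ltnP k r) => [lt_kr|rk].
    rewrite -big_mkcond (big_pred1 (Ordinal lt_kr)) => [|i]; first by rewrite exprVn.
    by rewrite [RHS]/= -[RHS]val_eqE /= eq_sym.
  rewrite big1 => [|i _]; last by rewrite ifF //; have := ltn_ord i; lia.
  have -> : tau k = 1; last by rewrite expr1n invr1.
  rewrite -t1; apply: eq_bigl => j; have := ltn_ord j; lia.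
case: (posnP k) => [k0|k_gt0].
  rewrite big1 => [|i _]; last by rewrite k0.
  rewrite mulr1; congr (_ ^- 2).
  rewrite /tau (big_pred1 k) // => j; rewrite /= -[RHS]val_eqE /= k0; lia.
have lt_kr : (k.-1 < r)%N by have := ltn_ord k; lia.
rewrite -big_mkcond (big_pred1 (Ordinal lt_kr)) /= => [|i]; last first.
  by rewrite /= -[RHS]val_eqE /=; lia.
rewrite (@tau_recr k.-1) ?prednK //.
have := tau_nz k.-1; have := t_nz k => n1 n2.
by field; rewrite n1 n2.
Qed.
End TodaShift.

(** * The Toda equation for the generating function *)

Theorem mainTheorem6 (R : realType) (r : nat) (hr : (1 <= r)%N)
    (t : 'I_r.+1 -> R[i]) (hbar : R[i]) (logt : 'I_r -> R[i])
    (ht : \prod_j t j = 1)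
    (hgen : generic t (cexp hbar))
    (hlog : forall i : 'I_r, cexp (logt i) = \prod_(j < r.+1 | (j <= i)%N) t j)
    (d : {ffun 'I_r -> nat}) (z : 'I_r.+1 -> R[i]) :
  toda hbar (Jfun hbar t logt) d z = (\sum_i t i ^- 2) * Jfun hbar t logt d z.
Proof.
(* For hbar = 0 one has v = 1, and genericity fails at i = j, m = 1. *)
have hbar0 : hbar != 0.
  apply/eqP => h0; have [] := hgen ord0 ord0 1; last by [].
  by rewrite h0 cexp0 exp1rz mulr1.
have tv : in_torus t (cexp hbar) by split=> //; exact: cexp_neq0.
pose q := cexp hbar ^+ 2; pose y := yparam t; pose dx := degree_ext d.
pose B := (\sum_k d k)%N.
have dB k : (k < r)%N -> dx k <= B%:Z.
  move=> kr; rewrite /dx -[k]/(nat_of_ord (Ordinal kr)) /degree_ext valK lez_nat.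
  by rewrite /B (bigD1 (Ordinal kr)) //= leq_addr.
pose Fs d' := Fsum q y r B r d' (fun=> 0%N).
pose M z' := prefactor hbar logt z' * \prod_i Qvar i z' ^+ d i.
have JE z' : Jfun hbar t logt d z' = M z' * Fs dx.
  by rewrite /Jfun (RGamma_Fsum tv hgen) /M /prefactor /Fs; ring.
(* Since Q_i Q^(d - e_i) = Q^d, this term carries the same monomial and prefactor [M] as J itself.
   For d_i = 0 both sides are 0. *)
have mulQE i z' : mulQ i (Jfun hbar t logt) d z' =
    M z' * Fs (fun k => dx k - (k == i)%:Z).
  rewrite /mulQ; case: posnP => [di0|di].
    rewrite /Fs (@Fsum_neg _ _ _ _ _ _ _ _ i) ?mulr0 //.
    by rewrite /dx /degree_ext valK di0 eqxx.
  set d' : {ffun 'I_r -> nat} := [ffun k => _].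
  have d'E k : (k < r)%N -> degree_ext d' k = dx k - (k == i)%:Z.
    move=> kr; rewrite /dx -[k]/(nat_of_ord (Ordinal kr)) /degree_ext !valK ffunE.
    rewrite -val_eqE /=; case: eqP => [Ek|_]; last by rewrite subn0 subr0.
    have -> : Ordinal kr = i by exact: val_inj.
    by rewrite -subzn.
  rewrite /Jfun (RGamma_Fsum tv hgen) -/(prefactor hbar logt z').
  have -> : Fsum (cexp hbar ^+ 2) (yparam t) r (\sum_k d' k) r (degree_ext d') (fun=> 0%N) =
      Fs (fun k => dx k - (k == i)%:Z).
    rewrite (@Fsum_bound _ _ _ _ _ B); last 2 first.
    - move=> k kr; rewrite -[k]/(nat_of_ord (Ordinal kr)) /degree_ext valK lez_nat.
      by rewrite (bigD1 (Ordinal kr)) //= leq_addr.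
    - by move=> k kr; rewrite d'E // (le_trans _ (dB k kr)) // lerBlDr lerDl.
    by apply: eq_Fsum.
  rewrite /M; have -> : \prod_k Qvar k z' ^+ d k = Qvar i z' * \prod_k Qvar k z' ^+ d' k.
    rewrite [LHS](bigD1 i) //= [in RHS](bigD1 i) //= mulrA ffunE eqxx subn1 -exprS prednK //.
    by congr (_ * _); apply: eq_bigr => k ki; rewrite ffunE (negPf ki) subn0.
  by ring.
have Mshift k z' : M (shift2 hbar k z') =
    (y k)^-1 * q ^ (dx k - (if (0 < k)%N then dx k.-1 else 0)) * M z'.
  rewrite /M (prefactor_shift2 ht hbar0 hlog) monomial_shift2 /y /yparam inord_val.
  by rewrite -/q -/dx; ring.
have yE (i : 'I_r) : lift ord0 i = i.+1 :> nat by rewrite lift0.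
have T := @Fsum_toda _ q y r (q_neq0 tv) (y_neq0 tv) (y_gen hgen) B r dx (fun=> 0%N) (leqnn r) dB.
have dxr : dx r = (\sum_(j < r.+1) 0)%N%:Z.
  by rewrite big1 // /dx /degree_ext insubN // ltnn.
have {}T := T dxr.
rewrite /toda Tshift2E JE Mshift.
transitivity (M z * ((y 0%N)^-1 * q ^ dx 0%N * Fs dx + \sum_(k < r) (y k.+1)^-1 *
   q ^ (dx k.+1 - dx k) * (Fs dx - Fs (fun i => dx i - (i == k)%:Z)))).
  rewrite mulrDr; congr (_ + _); first by rewrite /= subr0; ring.
  rewrite mulr_sumr; apply: eq_bigr => i _.
  rewrite Tshift2E JE mulQE Mshift yE /=; ring.
rewrite T JE mulrCA; congr (_ * _).
(* At the zero row the eigenvalue \sum_i q^(p_i) / y_i reduces to \sum_i t_i^-2. *)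
by apply: eq_bigr => i _; rewrite /xnode expr0 mul1r /y /yparam inord_val.
Qed.
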